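(* Let $r:\mathbb R\to(0,\infty)$ be continuous and let $0\le q\in L_1^{\rm loc}(\mathbb R)$. Let $p\in(1,\infty)$, $p'=p(p-1)^{-1}$, and suppose that there exists $a\in(0,\infty)$ such that $$\inf_{x\in\mathbb R}\int_{x-a}^{x+a}\frac{q(t)}{r(t)}\,dt>0 .$$ Then the problem $$-r(x)y'(x)+q(x)y(x)=f(x),\quad x\in\mathbb R,\qquad \lim_{|x|\to\infty}y(x)=0$$ is correctly solvable in $L_p(\mathbb R)$ if and only if $$A_{p'}:=\sup_{x\in\mathbb R}\int_{x-d(x)}^{x+d(x)}\frac{dt}{r(t)^{p'}}<\infty .$$ Moreover, $\|G\|_{p\to p}\le c\,d_0^{1/p}A_{p'}^{1/p'}$ with an absolute constant $c>0$, where $d_0=\sup_{x\in\mathbb R}d(x)$ (the right-hand side being understood as $+\infty$ if $A_{p'}=\infty$).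
   Context: $L_p(\mathbb R)$ is the usual Lebesgue space with norm $\|\cdot\|_p$. A solution of the problem (for given $f\in L_p(\mathbb R)$) is any function $y$ on $\mathbb R$, absolutely continuous on every compact interval, that satisfies the differential equation almost everywhere on $\mathbb R$ and satisfies $y(x)\to0$ as $|x|\to\infty$. The problem is called correctly solvable in $L_p(\mathbb R)$ if (I) for every $f\in L_p(\mathbb R)$ there exists a unique solution $y\in L_p(\mathbb R)$, and (II) there is a constant $c_p\in(0,\infty)$, independent of $f$, such that $\|y\|_p\le c_p\|f\|_p$ for all $f\in L_p(\mathbb R)$. For $x\in\mathbb R$, $d(x)=\inf\{d>0:\int_{x-d}^{x+d}\frac{q(t)}{r(t)}dt=2\}$ (well defined when $\int_{-\infty}^0\frac{q(t)}{r(t)}dt=\infty$, which is the case under the hypothesis of the theorem). $G$ is the integral operator $(Gf)(x)=\int_x^\infty\frac{1}{r(t)}\exp\big(-\int_x^t\frac{q(s)}{r(s)}ds\big)f(t)\,dt$, $x\in\mathbb R$, and $\|G\|_{p\to p}$ is its operator norm on $L_p(\mathbb R)$. *)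

(* Defs.v *)
From HB Require Import structures.
From mathcomp Require Import all_boot all_order all_algebra.
From mathcomp Require Import all_classical all_reals all_analysis.

Set Implicit Arguments.
Unset Strict Implicit.
Unset Printing Implicit Defensive.

Import Order.TTheory GRing.Theory Num.Theory.
Import numFieldNormedType.Exports.

Local Open Scope classical_set_scope.
Local Open Scope ring_scope.

Definition abs_continuous {R : realType} (a b : R) (y : R -> R) : Prop :=
  forall e : R, 0 < e -> exists2 delta : R, 0 < delta &
    forall (n : nat) (u v : 'I_n -> R),
      (forall i, a <= u i /\ u i <= v i /\ v i <= b) ->
      trivIset setT (fun i => `]u i, v i[%classic) ->
      \sum_(i < n) (v i - u i) < delta ->
      \sum_(i < n) `|y (v i) - y (u i)| < e.

Definition is_solution {R : realType} (r q f y : R -> R) : Prop :=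
  [/\ forall a b : R, abs_continuous a b y,
      {ae (@lebesgue_measure R), forall x : R,
        derivable y x 1 /\ - r x * derive1 y x + q x * y x = f x},
      y x @[x --> -oo] --> 0 &
      y x @[x --> +oo] --> 0].

Definition correctly_solvable {R : realType} (p : R) (r q : R -> R) : Prop :=
  (forall f : R -> R, f \in Lfun (@lebesgue_measure R) p%:E ->
     exists! y : R -> R,
       is_solution r q f y /\ y \in Lfun (@lebesgue_measure R) p%:E) /\
  (exists2 c : R, 0 < c &
     forall f y : R -> R, f \in Lfun (@lebesgue_measure R) p%:E ->
       is_solution r q f y -> y \in Lfun (@lebesgue_measure R) p%:E ->
       ('N[@lebesgue_measure R]_(p%:E)[EFin \o y]
          <= c%:E * 'N[@lebesgue_measure R]_(p%:E)[EFin \o f])%E).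

Definition qr_integral {R : realType} (r q : R -> R) (x d : R) : \bar R :=
  (\int[@lebesgue_measure R]_(t in `[(x - d)%R, (x + d)%R])
     (q t / r t)%:E)%E.

(* inf set0 = 0 in the library; the set below is nonempty when the integral of
   q / r over the left half-line is infinite. *)
Definition d_fun {R : realType} (r q : R -> R) (x : R) : R :=
  inf [set d : R | 0 < d /\ qr_integral r q x d = 2%:E].

Definition d_sup {R : realType} (r q : R -> R) : \bar R :=
  ereal_sup (range (fun x : R => (d_fun r q x)%:E)).

Definition A_sup {R : realType} (r q : R -> R) (s : R) : \bar R :=
  ereal_sup (range (fun x : R =>
    (\int[@lebesgue_measure R]_(t in
        `[(x - d_fun r q x)%R, (x + d_fun r q x)%R]) ((r t `^ s)^-1)%:E)%E)).

Definition G_integrand {R : realType} (r q f : R -> R) (x t : R) : R :=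
  (r t)^-1 *
  expR (- \int[@lebesgue_measure R]_(s in `[x, t]) (q s / r s)) * f t.

Definition G_op {R : realType} (r q f : R -> R) (x : R) : R :=
  \int[@lebesgue_measure R]_(t in `[x, +oo[) G_integrand r q f x t.

(* The integrability clause is needed because a divergent integral has a
   default value in the library. When no C qualifies, in particular when G is
   not defined on all of L_p, the norm is ereal_inf set0 = +oo. *)
Definition G_norm {R : realType} (p : R) (r q : R -> R) : \bar R :=
  ereal_inf [set C%:E | C in [set C : R | 0 <= C /\
    forall f : R -> R, f \in Lfun (@lebesgue_measure R) p%:E ->
      [/\ forall x : R, (@lebesgue_measure R).-integrable `[x, +oo[
            (EFin \o G_integrand r q f x),
          G_op r q f \in Lfun (@lebesgue_measure R) p%:E &
          ('N[@lebesgue_measure R]_(p%:E)[EFin \o G_op r q f]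
             <= C%:E * 'N[@lebesgue_measure R]_(p%:E)[EFin \o f])%E]]].

(* Main.v *)
Require Import Defs.
From HB Require Import structures.
From mathcomp Require Import all_boot all_order all_algebra.
From mathcomp Require Import all_classical all_reals all_analysis.
From mathcomp Require Import measurable_realfun ring lra.
Import Order.TTheory GRing.Theory Num.Theory.
Import numFieldNormedType.Exports.
Local Open Scope classical_set_scope.
Local Open Scope ring_scope.

(** Let Q be a primitive of q / r. A function y satisfies the equation exactly
when (e^{-Q} y)' = - e^{-Q} f / r almost everywhere, and an absolutely
continuous function is determined up to a constant by its derivative, so for
a <= b every solution satisfies (solution_repr)
  e^{-Q(a)} y(a) - e^{-Q(b)} y(b) = \int_a^b e^{-Q} f / r.
Since Q is nondecreasing and y vanishes at +oo, letting b tend to +oo gives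
uniqueness (solution_unique) and identifies the solution with G f.

The hypothesis on the windows of radius a says that Q grows by at least 2 over
intervals of some fixed length. The intervals [x - d(x), x + d(x)] are windows
over which Q grows by exactly 2, and every point is the left end of one such
window and the right end of another (step_right, step_left). Cut a half-line
starting at x into consecutive windows: the weight e^{-|Q(t) - Q(x)|} loses a
factor e^{-2} <= 1/2 from each window to the next, so the integral of a
nonnegative g against this weight is at most twice the largest integral of g
over a window (kernel_mass_right, kernel_mass_left). With g = r^{-p'} on the
right this gives the bound 2 A_{p'}, and with g = 1 on the left the bound 4 d_0.

Sufficiency and the norm bound. Sharing the weight between the two factors of
Hoelder's inequality gives
  |G f(x)|^p <= (2 A_{p'})^{p/p'} W(x),
  W(x) = \int_x^oo e^{-(Q(t) - Q(x))} |f(t)|^p dt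
(G_op_powR_le). By Tonelli and the bound 4 d_0, \int W <= 4 d_0 ||f||_p^p, hence
||G f||_p <= (2 A_{p'})^{1/p'} (4 d_0)^{1/p} ||f||_p, and the constant is at
most 4 because 1/p + 1/p' = 1 (green_constant_le). Moreover W tends to 0 at
both ends of the line, hence so does G f.

Necessity. Solvability for every f in L_p is enough. If A_{p'} is infinite,
there are windows D_k whose mass B_k = \int_{D_k} r^{-p'} is as large as wanted.
The function f = (r^{-p'} \sum_k 2^{-(k+1)} 1_{D_k} / B_k)^{1/p} is nonnegative
with ||f||_p <= 1, and the representation formula bounds its solution from below
by e^{-2} \int_{D_k} f / r >= e^{-2} 2^{-(k+1)} B_k^{1/p'} at the left end of D_k.
With B_k growing fast enough the solution is unbounded, whereas a continuous
function with limits at -oo and +oo is bounded. *)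

Set Implicit Arguments.
Unset Strict Implicit.
Unset Printing Implicit Defensive.

(** * Absolutely continuous functions *)

Section ac.
Context {R : realType}.
Implicit Types (a b : R) (y z : R -> R).

(** Cousin's lemma in the form of an induction principle: the supremum of the w
such that P a w holds can always be pushed further to the right, so a property
that is additive and holds on all small intervals around each point holds on the
whole interval. *)
Lemma compactness_induction (P : R -> R -> Prop) a b : a <= b ->
  (forall u w v, u <= w -> w <= v -> P u w -> P w v -> P u v) ->
  (forall x, a <= x <= b -> exists2 d : R, 0 < d &
     forall u v, a <= u -> u <= x -> x <= v -> v <= b -> v - u < d -> P u v) ->
  P a b.
Proof.
move=> ab Padd Ploc.
pose S := [set w | a <= w <= b /\ P a w].
have Sa : S a.
  split; first by rewrite lexx.
  have [|d d0 Pd] := Ploc a; first by rewrite lexx.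
  by apply: Pd; rewrite // subrr.
have supS : has_sup S by split; [exists a|exists b => w [/andP[]]].
have ca : a <= sup S by apply: ub_le_sup => //; case: supS.
have cb : sup S <= b by apply: ge_sup => [|w [/andP[]]//]; exists a.
have [|d d0 Pd] := Ploc (sup S); first by rewrite ca cb.
have d20 : 0 < d / 2 by rewrite divr_gt0.
have [w [/andP[aw wb] Paw] wS] := sup_adherent d20 supS.
have wc : w <= sup S by apply: ub_le_sup; [case: supS|split; rewrite ?aw].
pose v := Num.min b (sup S + d / 3).
have cv : sup S <= v by rewrite le_min cb lerDl divr_ge0// ltW.
have vd : v <= sup S + d / 3 by rewrite ge_min lexx orbT.
have vb : v <= b by rewrite ge_min lexx.
have Pwv : P w v by apply: Pd => //; lra.
have Pav : P a v by apply: Padd Paw Pwv => //; exact: le_trans cv.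
have vS : v <= sup S.
  by apply: ub_le_sup; [case: supS|split => //; rewrite vb (le_trans ca)].
suff -> : b = v by [].
by apply/eqP; move: vS; rewrite /v; case: (leP b) => // _ vS; exfalso; lra.
Qed.

(** Finitely many intervals listed from left to right inside [a, b]. Unlike the
families indexed by an ordinal type in the definition of absolute continuity,
such lists are concatenated without reindexing. *)
Fixpoint chain a (s : seq (R * R)) b : Prop :=
  if s is (u, v) :: s' then [/\ a <= u, u <= v & chain v s' b] else a <= b.

Lemma chain_cat a w b s t : chain a s w -> chain w t b -> chain a (s ++ t) b.
Proof.
elim: s a => [|[u v] s IH] a /=; last by move=> [au uv /IH h] /h.
case: t => [|[u v] t] /= aw; first exact: le_trans.
by move=> [wu uv h]; split => //; exact: le_trans wu.
Qed.

Lemma chain_le a b s : chain a s b -> a <= b.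
Proof.
elim: s a => [//|[u v] s IH] a /= [au uv /IH vb].
exact: le_trans (le_trans au uv) vb.
Qed.

Lemma chain_nth a b s : chain a s b -> forall i, (i < size s)%N ->
  [/\ a <= (nth 0 s i).1, (nth 0 s i).1 <= (nth 0 s i).2,
      (nth 0 s i).2 <= b & forall j, (i < j < size s)%N ->
      (nth 0 s i).2 <= (nth 0 s j).1].
Proof.
elim: s a => [//|[u v] s IH] a /= [au uv cs] [|i] /=.
  move=> _; split => //; first exact: chain_le cs.
  by move=> [//|j] /= js; have [] := IH _ cs _ js.
rewrite ltnS => /(IH _ cs)[vi ii ib ij]; split => //.
  exact: le_trans (le_trans au uv) vi.
by move=> [//|j]; rewrite !ltnS => /ij.
Qed.

Lemma ac_chain a b y : abs_continuous a b y ->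
  forall e : R, 0 < e -> exists2 d : R, 0 < d & forall s, chain a s b ->
    \sum_(i <- s) (i.2 - i.1) < d -> \sum_(i <- s) `|y i.2 - y i.1| < e.
Proof.
move=> acy e /acy[d d0 dP]; exists d => // s cs.
have cn := chain_nth cs.
rewrite !(big_nth (0 : R * R)) !big_mkord; apply: dP => [i|].
  by have [] := cn _ (ltn_ord i).
suff H (i j : 'I_(size s)) t : (i < j)%N ->
    (nth (0 : R * R) s i).1 < t < (nth (0 : R * R) s i).2 ->
    (nth (0 : R * R) s j).1 < t < (nth (0 : R * R) s j).2 -> False.
  move=> i j _ _ [t [/=]]; rewrite !in_itv/= => ti tj; apply/val_inj/eqP.
  by case: ltngtP => // ij; exfalso; [exact: H ij ti tj|exact: H ij tj ti].
move=> ij /andP[_ ti] /andP[jt _].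
have [_ _ _ /(_ j)] := cn _ (ltn_ord i).
rewrite ij ltn_ord => /(_ isT) h.
by have := lt_le_trans (lt_trans jt ti) h; rewrite ltxx.
Qed.

Lemma derive0_small y x e : 0 < e -> derivable y x 1 -> derive1 y x = 0 ->
  exists2 d : R, 0 < d & forall t, `|t - x| < d -> `|y t - y x| <= e * `|t - x|.
Proof.
move=> e0 dy y'0.
have : h^-1 *: ((y \o shift x) h%:A - y x) @[h --> 0^'] --> (0 : R).
  by rewrite -[X in _ --> X]y'0 derive1E; exact: dy.
move=> /cvgrPdist_le/(_ _ e0)[d /= d0 dP]; exists d => // t td.
have [->|tx] := eqVneq t x; first by rewrite !subrr normr0 mulr0.
have := dP (t - x); rewrite /= sub0r normrN => /(_ td).
rewrite subr_eq0 tx => /(_ isT).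
rewrite sub0r normrN normrM normfV ler_pdivrMl; last by rewrite normr_gt0 subr_eq0.
by rewrite /= [_ *: 1]mulr1 subrK mulrC.
Qed.

(** Cover the exceptional null set by an open set U of measure less than the
delta of absolute continuity. Around a point with derivative 0 the increment of y
is at most e times the length; an interval around an exceptional point lies in U,
and the intervals of this second kind have total length at most the measure of U,
so that together they contribute at most e. Compactness induction patches the two
kinds of intervals together. *)
Lemma ac_null_derivative_cst a b y : a <= b -> abs_continuous a b y ->
  {ae (@lebesgue_measure R), forall x, derivable y x 1 /\ derive1 y x = 0} ->
  y a = y b.
Proof.
move=> ab acy [N [mN N0 sN]].
suff H e : 0 < e -> `|y b - y a| <= e * (b - a) + e.
  apply/eqP; rewrite -subr_eq0 -normr_eq0 distrC eq_le normr_ge0 andbT.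
  apply/ler_addgt0Pl => e e0; rewrite addr0.
  have d0 : 0 < b - a + 1 by lra.
  have := H (e / (b - a + 1)) (divr_gt0 e0 d0).
  suff -> : e / (b - a + 1) * (b - a) + e / (b - a + 1) = e by [].
  by field; rewrite gt_eqF.
move=> e0.
have [d d0 dP] := ac_chain acy e0.
have [|U [oU NU]] := lebesgue_regularity_outer mN _ d0.
  by move: N0 => /= ->; rewrite ltry.
have {}N0 : (@lebesgue_measure R N = 0)%E by exact: N0.
have mU : measurable U by exact: open_measurable.
have UN0 : (@lebesgue_measure R (U `&` N) = 0)%E.
  by apply: (subset_measure0 _ _ _ N0) => //; exact: measurableI.
move=> UNd; have Ud : (@lebesgue_measure R U < d%:E)%E.
  by rewrite (@measureDI _ _ _ (@lebesgue_measure R) _ _ mU mN) [X in (_ + X)%E]UN0 adde0; exact: UNd.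
pose len (s : seq (R * R)) := \sum_(i <- s) (i.2 - i.1).
pose inc (s : seq (R * R)) := \sum_(i <- s) `|y i.2 - y i.1|.
(* The list s collects the intervals around exceptional points; its total length
   is compared with the measure of U within [u, v[ to make P additive. *)
pose P u v := exists s, [/\ chain u s v, `|y v - y u| <= e * (v - u) + inc s &
  ((len s)%:E <= lebesgue_measure (U `&` `[u, v[%classic))%E].
have [] : P a b; last first.
  move=> s [cs ys ls]; apply: le_trans ys _; rewrite lerD2l ltW// dP//.
  rewrite -lte_fin; apply: le_lt_trans Ud; apply: le_trans ls _.
  by apply: le_measure; rewrite ?inE//; exact: measurableI.
apply: compactness_induction => // [u w v uw wv [s [cs ys ls]] [t [ct yt lt]]|x xab].
  exists (s ++ t); split; first exact: chain_cat ct.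
    rewrite /inc big_cat/= -/(inc s) -/(inc t).
    have -> : y v - y u = (y v - y w) + (y w - y u) by ring.
    by apply: le_trans (ler_normD _ _) _; lra.
  rewrite /len big_cat/= -/(len s) -/(len t) EFinD.
  apply: le_trans (leeD ls lt) _.
  rewrite -measureU//; first last.
  - rewrite -subset0 => r /= []; rewrite !in_itv/=.
    by move=> [_ /andP[_ rw]] [_ /andP[]]; rewrite leNgt rw.
  - exact: measurableI.
  - exact: measurableI.
  apply: le_measure; rewrite ?inE//.
  - by apply: measurableU; exact: measurableI.
  - exact: measurableI.
  - move=> r /=; rewrite !in_itv/= => -[[Ur /andP[ur rw]]|[Ur /andP[wr rv]]]; split => //.
      by rewrite ur (lt_le_trans rw).
    by rewrite rv (le_trans uw).
have [Nx|Nx] := pselect (N x).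
  have /nbhs_ballP[h/= h0 hU] : nbhs x U by apply: open_nbhs_nbhs; split => //; exact: NU.
  exists h => // u v au ux xv vb vuh; exists [:: (u, v)]; split => /=.
  - by split => //; exact: le_trans xv.
  - by rewrite /inc big_seq1/= lerDr mulr_ge0 ?(ltW e0)// subr_ge0 (le_trans ux xv).
  - have -> : len [:: (u, v)] = v - u by rewrite /len big_seq1.
    rewrite (_ : U `&` _ = `[u, v[%classic); last first.
      apply/seteqP; split => [r []//|r /= ruv]; split => //.
      apply: hU; move: ruv; rewrite in_itv/= /ball/= ltr_norml => /andP[ur rv].
      by apply/andP; split; lra.
    have := le_trans ux xv; rewrite le_eqVlt => /predU1P[->|uv].
      by rewrite subrr measure_ge0.
    by rewrite lebesgue_measure_itv/= lte_fin uv EFinB.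
have [dy y'0] : derivable y x 1 /\ derive1 y x = 0.
  by apply: contrapT => h; apply: Nx; exact: sN.
have [h h0 hP] := derive0_small e0 dy y'0.
exists h => // u v au ux xv vb vuh; exists [::]; split => /=.
- exact: le_trans xv.
- rewrite /inc big_nil addr0.
  have -> : y v - y u = (y v - y x) - (y u - y x) by ring.
  apply: le_trans (ler_normB _ _) _.
  have -> : e * (v - u) = e * (v - x) + e * (x - u) by ring.
  apply: lerD.
    rewrite -[X in e * X]ger0_norm ?subr_ge0//; apply: hP.
    by rewrite ger0_norm ?subr_ge0//; lra.
  rewrite -[X in e * X]ger0_norm ?subr_ge0// distrC (distrC x) distrC; apply: hP.
  by rewrite distrC ger0_norm ?subr_ge0//; lra.
- by rewrite /len big_nil measure_ge0.
Qed.

(** The common source of the stability of absolute continuity under sums,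
products and exponentials. *)
Lemma ac_lip a b y z t (M : R) : 0 <= M ->
  abs_continuous a b y -> abs_continuous a b z ->
  (forall u v, a <= u -> u <= v -> v <= b ->
     `|t v - t u| <= M * (`|y v - y u| + `|z v - z u|)) ->
  abs_continuous a b t.
Proof.
move=> M0 acy acz tM e e0.
have e1 : 0 < e / (2 * (M + 1)) by rewrite divr_gt0// mulr_gt0//; lra.
have [d1 d10 d1P] := acy _ e1.
have [d2 d20 d2P] := acz _ e1.
exists (Num.min d1 d2); first by rewrite lt_min d10.
move=> n u v uv tuv; rewrite lt_min => /andP[h1 h2].
have {}h1 := d1P n u v uv tuv h1.
have {}h2 := d2P n u v uv tuv h2.
apply: (@le_lt_trans _ _
    (M * (\sum_(i < n) `|y (v i) - y (u i)| + \sum_(i < n) `|z (v i) - z (u i)|))).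
  rewrite -big_split/= mulr_sumr; apply: ler_sum => i _.
  by have [? []] := uv i; exact: tM.
have M1 : 0 < M + 1 by lra.
have := ltrD h1 h2; set S := _ + _.
have -> : e / (2 * (M + 1)) + e / (2 * (M + 1)) = e / (M + 1).
  by field; rewrite gt_eqF.
rewrite ltr_pdivlMr// mulrC => h.
by apply: le_lt_trans h; rewrite ler_wpM2r// ?addr_ge0 ?sumr_ge0//; lra.
Qed.

Lemma ac_cst a b (k : R) : abs_continuous a b (fun=> k).
Proof.
move=> e e0; exists 1 => // n u v _ _ _.
by rewrite big1// => i _; rewrite subrr normr0.
Qed.

Lemma ac_osc a b y : abs_continuous a b y -> forall e, 0 < e ->
  exists2 d : R, 0 < d & forall u v, a <= u -> u <= v -> v <= b ->
    v - u < d -> `|y v - y u| < e.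
Proof.
move=> acy e /(ac_chain acy)[d d0 dP]; exists d => // u v au uv vb vud.
have := dP [:: (u, v)]; rewrite !big_seq1/=; exact.
Qed.

Lemma ac_bounded a b y : abs_continuous a b y ->
  exists2 M : R, 0 <= M & forall x, a <= x <= b -> `|y x| <= M.
Proof.
have [ab|ba] := leP a b; last first.
  by exists 0 => // x /andP[ax xb]; have := le_trans ax xb; rewrite leNgt ba.
move=> acy.
have [d d0 dP] := ac_osc acy ltr01.
pose P u v := exists2 M : R, 0 <= M & forall x, u <= x <= v -> `|y x| <= M.
apply: (@compactness_induction P) => // [u w v uw wv [M M0 uM] [N N0 vN]|x xab].
  exists (M + N); first exact: addr_ge0.
  move=> x /andP[ux xv]; have [xw|wx] := leP x w.
    by rewrite ler_wpDr// uM// ux.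
  by rewrite ler_wpDl// vN// xv (ltW wx).
exists d => // u v au ux xv vb vud.
exists (`|y u| + 1) => [|t /andP[ut tv]]; first by rewrite addr_ge0.
have : `|y t - y u| < 1 by apply: dP => //; [exact: le_trans vb|lra].
by move=> /ltW h; rewrite -lerBlDl; apply: le_trans h; exact: lerB_dist.
Qed.

Lemma acD a b y z : abs_continuous a b y -> abs_continuous a b z ->
  abs_continuous a b (fun x => y x + z x).
Proof.
move=> acy acz; apply: (ac_lip ler01 acy acz) => u v _ _ _.
rewrite mul1r (_ : _ - _ = (y v - y u) + (z v - z u)); last by ring.
exact: ler_normD.
Qed.

Lemma acM a b y z : abs_continuous a b y -> abs_continuous a b z ->
  abs_continuous a b (fun x => y x * z x).
Proof.
move=> acy acz.
have [M M0 yM] := ac_bounded acy.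
have [N N0 zN] := ac_bounded acz.
apply: (ac_lip (addr_ge0 M0 N0) acy acz) => u v au uv vb.
rewrite (_ : _ - _ = (y v - y u) * z v + y u * (z v - z u)); last by ring.
rewrite (le_trans (ler_normD _ _))// !normrM mulrDr lerD//.
  rewrite mulrC ler_wpM2r//; apply: ler_wpDl => //.
  by apply: zN; rewrite vb (le_trans au).
rewrite ler_wpM2r//; apply: ler_wpDr => //.
by apply: yM; rewrite au (le_trans uv).
Qed.

Lemma ac_expR a b y : abs_continuous a b y ->
  abs_continuous a b (fun x => expR (y x)).
Proof.
move=> acy; have [M M0 yM] := ac_bounded acy.
apply: (ac_lip (expR_ge0 M) acy (ac_cst _ _ 0)) => u v au uv vb.
have yuM : y u <= M by apply: le_trans (ler_norm _) (yM _ _); rewrite au (le_trans uv).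
have yvM : y v <= M by apply: le_trans (ler_norm _) (yM _ _); rewrite vb (le_trans au).
rewrite subrr normr0 addr0.
suff H (s t : R) : s <= t -> t <= M -> `|expR t - expR s| <= expR M * `|t - s|.
  by case: (leP (y u) (y v)) => [|/ltW] uv'; [|rewrite distrC (distrC (y v))]; exact: H.
move=> st tM; rewrite !ger0_norm ?subr_ge0 ?ler_expR//.
apply: (@le_trans _ _ (expR t * (t - s))); last first.
  by rewrite ler_wpM2r ?subr_ge0 ?ler_expR.
have -> : expR s = expR t * expR (s - t) by rewrite -expRD addrC subrK.
rewrite -[X in X - _]mulr1 -mulrBr ler_wpM2l ?expR_ge0//.
by have := expR_ge1Dx (s - t); lra.
Qed.

Lemma ac_cont y : (forall a b, abs_continuous a b y) -> continuous y.
Proof.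
move=> acy x; apply/cvgrPdist_lt => e e0.
have [d d0 dP] := ac_osc (acy (x - 1) (x + 1)) e0.
near=> t.
have tx : `|x - t| < Num.min d 1.
  by near: t; apply: (@cvgr_dist_lt _ R^o _ _ _ id) => //; rewrite lt_min d0/=.
move: tx; rewrite lt_min => /andP[td t1].
case: (leP t x) => [xt|/ltW xt].
  by move: td t1; rewrite ger0_norm ?subr_ge0// => ? ?; apply: dP => //; lra.
move: td t1; rewrite distrC ger0_norm ?subr_ge0// => ? ?.
by rewrite distrC; apply: dP => //; lra.
Unshelve. all: by end_near. Qed.

End ac.

(** * Indefinite integrals of locally integrable functions *)

Section primitive.
Context {R : realType}.
Local Notation mu := (@lebesgue_measure R).
Implicit Types (a b x : R) (f g h y : R -> R).

Lemma locint_itv g a b : locally_integrable setT g ->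
  mu.-integrable `[a, b] (EFin \o g).
Proof.
move=> [mg _ ig]; apply/integrableP; split.
  by apply/measurable_EFinP; exact: measurable_funS mg.
by apply: ig => //; exact: segment_compact.
Qed.

(** A continuous factor is bounded on each compact set. *)
Lemma locint_cM g h : locally_integrable setT g -> continuous h ->
  locally_integrable setT (fun x => h x * g x).
Proof.
move=> [mg oT ig] ch.
have mh : measurable_fun setT h by exact: continuous_measurable_fun.
split => //; first exact: measurable_funM.
move=> K KT cK.
have mK : measurable K by exact: compact_measurable.
have [M [Mr hM]] : bounded_set (h @` K).
  apply: compact_bounded; apply: continuous_compact => //.
  exact: continuous_subspaceT.
pose N := `|M| + 1.
have N0 : 0 <= N by exact: addr_ge0.
have hN x : K x -> `|h x| <= N.
  move=> Kx; apply: (hM N); last by exists x.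
  by rewrite (le_lt_trans (ler_norm M))// ltrDl.
apply: (@le_lt_trans _ _ (\int[mu]_(x in K) (N%:E * `|g x|%:E))%E).
  apply: ge0_le_integral => //.
  - apply/measurable_EFinP/measurableT_comp => //.
    by apply: measurable_funS (measurable_funM mh mg).
  - apply/measurable_EFinP/measurable_funM => //.
    by apply: measurableT_comp => //; exact: measurable_funS mg.
  - by move=> x Kx; rewrite -EFinM lee_fin normrM ler_wpM2r// hN.
rewrite ge0_integralZl//.
- by rewrite lte_mul_pinfty// ig.
- by apply/measurable_EFinP/measurableT_comp => //; exact: measurable_funS mg.
Qed.

Lemma continuous_locint h : continuous h -> locally_integrable setT h.
Proof.
move=> ch; have : locally_integrable setT (fun x => h x * cst 1 x).
  apply: locint_cM => //; rewrite (_ : cst 1 = \1_setT); last first.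
    by apply/funext => x; rewrite indicT.
  exact: locally_integrable_indic openT measurableT.
by under [X in locally_integrable _ X -> _]eq_fun do rewrite /= mulr1.
Qed.

(** Makes L_p functions locally integrable by comparison with 1 + |f|^p. *)
Lemma ge1_powR_bound (s p : R) : 0 <= s -> 1 <= p -> s <= 1 + s `^ p.
Proof.
move=> s0 p1; have [s1|s1] := leP s 1; first by rewrite ler_wpDr// powR_ge0.
by rewrite ler_wpDl// le1r_powR// ltW.
Qed.

Lemma measurable_powR_comp d (T : measurableType d) (D : set T) (k : T -> R) (p : R) :
  measurable_fun D k -> measurable_fun D (fun t => k t `^ p).
Proof. exact: (@measurableT_comp _ _ _ _ _ _ (@powR R ^~ p)). Qed.

Lemma Lfun_measurable f p : f \in Lfun mu p -> measurable_fun setT f.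
Proof. by move=> /sub_Lfun_mfun; rewrite inE. Qed.

Lemma Lfun_powR_lty f p : 0 < p -> f \in Lfun mu p%:E ->
  (\int[mu]_x (`|f x| `^ p)%:E < +oo)%E.
Proof.
move=> p0 /sub_Lfun_finLfun; rewrite inE /finite_norm unlock => H.
apply: lty_poweRy H => /=; by rewrite invr_neq0// gt_eqF.
Qed.

Lemma Lfun_locint f p : 1 <= p -> f \in Lfun mu p%:E -> locally_integrable setT f.
Proof.
move=> p1 fp; have mf := Lfun_measurable fp; split => //; first exact: openT.
move=> K _ cK; have mK : measurable K by exact: compact_measurable.
have [a [ar Ka]] := compact_bounded cK.
have p0 : 0 < p by exact: lt_le_trans p1.
apply: (@le_lt_trans _ _ (\int[mu]_(x in K) (1 + (`|f x| `^ p)%:E))%E).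
  apply: ge0_le_integral => //.
  - by apply/measurable_EFinP/measurableT_comp => //; exact: measurable_funS mf.
  - apply: emeasurable_funD => //; apply/measurable_EFinP.
    apply: measurable_powR_comp.
    by apply/measurableT_comp => //; exact: measurable_funS mf.
  - by move=> x _; rewrite -EFinD lee_fin ge1_powR_bound.
rewrite ge0_integralD//; first last.
- apply/measurable_EFinP; apply: measurable_powR_comp.
  by apply/measurableT_comp => //; exact: measurable_funS mf.
rewrite integral_cst// mul1e lte_add_pinfty//.
  exact: compact_finite_measure.
apply: le_lt_trans (Lfun_powR_lty p0 fp).
apply: ge0_subset_integral => //.
apply/measurable_EFinP; apply: measurable_powR_comp.
by apply/measurableT_comp => //; exact: measurable_funS mf.
Qed.

(** At most one of the two integrals is over a nondegenerate interval, whence a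
primitive with base point 0 on both half-lines. *)
Definition prim g x : R :=
  \int[mu]_(t in `[0, x]) g t - \int[mu]_(t in `[x, 0]) g t.

Lemma Rintegral_split g a b x : locally_integrable setT g -> a <= x -> x <= b ->
  \int[mu]_(t in `[a, b]) g t =
  \int[mu]_(t in `[a, x]) g t + \int[mu]_(t in `[x, b]) g t.
Proof.
move=> lg ax xb; apply/eqP; rewrite addrC -subr_eq; apply/eqP.
rewrite Rintegral_itvB ?bnd_simp//; last exact: locint_itv.
rewrite Rintegral_itv_obnd_cbnd//.
by apply: (integrableS _ _ _ (locint_itv x b lg)) => //; apply: subset_itvr; rewrite bnd_simp.
Qed.

Lemma Rintegral_itvxx g x : \int[mu]_(t in `[x, x]) g t = 0.
Proof. by rewrite set_itv1 Rintegral_set1. Qed.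

Lemma Rintegral_itv_lt g a b : b < a -> \int[mu]_(t in `[a, b]) g t = 0.
Proof. by move=> ba; rewrite set_itv_ge ?Rintegral_set0// bnd_simp -ltNge. Qed.

Lemma prim_sub g a b : locally_integrable setT g -> a <= b ->
  prim g b - prim g a = \int[mu]_(t in `[a, b]) g t.
Proof.
move=> lg ab; rewrite /prim.
have [a0|a0] := leP 0 a.
  have b0 := le_trans a0 ab.
  have h x : 0 <= x -> \int[mu]_(t in `[x, 0]) g t = 0.
    rewrite le_eqVlt => /predU1P[<-|]; first exact: Rintegral_itvxx.
    exact: Rintegral_itv_lt.
  by rewrite !h// !subr0 (Rintegral_split lg a0 ab) addrC addKr.
rewrite (Rintegral_itv_lt g a0).
have [b0|b0] := leP 0 b.
  rewrite (Rintegral_split lg (ltW a0) b0).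
  have -> : \int[mu]_(t in `[b, 0]) g t = 0.
    move: b0; rewrite le_eqVlt => /predU1P[<-|]; first exact: Rintegral_itvxx.
    exact: Rintegral_itv_lt.
  by rewrite subr0 sub0r opprK addrC.
rewrite (Rintegral_itv_lt g b0) (Rintegral_split lg ab (ltW b0)); ring.
Qed.

(** The increments over disjoint intervals add up to at most the integral of |g|
over their union, which is small when the union has small measure. *)
Lemma prim_ac g a b : locally_integrable setT g -> abs_continuous a b (prim g).
Proof.
move=> lg e e0.
pose gab := g \_ `[a, b].
have ig : mu.-integrable setT (EFin \o gab).
  by rewrite /gab -restrict_EFin -integrable_mkcond//; exact: locint_itv.
have [d [d0 dP]] := integral_normr_continuous ig e0.
exists d => // n u v uv tuv sd.
pose I i := `]u i, v i[%classic.
pose A := \big[setU/set0]_(i <- index_enum 'I_n) I i.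
have mI i : measurable (I i) by exact: measurable_itv.
have mA : measurable A by exact: bigsetU_measurable.
have tI : trivIset [set` index_enum 'I_n] I.
  by apply: sub_trivIset tuv.
have intA h : measurable_fun setT h -> (forall x, 0 <= h x) ->
    (\int[mu]_(x in A) (h x)%:E = \sum_(i < n) \int[mu]_(x in I i) (h x)%:E)%E.
  move=> mh h0; apply: ge0_integral_bigsetU => //.
  - exact: index_enum_uniq.
  - by apply/measurable_EFinP; exact: measurable_funS mh.
  - by move=> x _; rewrite lee_fin.
have int1 B : measurable B -> (\int[mu]_(x in B) (cst (1 : R) x)%:E = mu B)%E.
  by move=> mB; rewrite -[RHS]mul1e -integral_cst.
have muA : (mu A < d%:E)%E.
  rewrite -(int1 _ mA) intA//.
  rewrite (_ : (\sum_(i < n) _)%E = (\sum_(i < n) (v i - u i))%:E); last first.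
    rewrite -sumEFin; apply: eq_bigr => i _; rewrite (int1 _ (mI i)).
    rewrite lebesgue_measure_itv/= lte_fin; have [_ [uvi _]] := uv i.
    by move: uvi; rewrite le_eqVlt => /predU1P[->|->//]; rewrite ltxx subrr.
  by rewrite lte_fin.
have {dP} := dP A mA muA; apply: le_lt_trans.
have mgab : measurable_fun setT (fun x => `|gab x|).
  by apply: measurableT_comp => //; apply/measurable_EFinP; exact: measurable_int ig.
have igA : mu.-integrable A (EFin \o (fun x => `|gab x|)).
  by apply: integrableS (integrable_norm ig) => //.
rewrite -lee_fin fineK ?integrable_fin_num// intA//.
rewrite -sumEFin; apply: lee_sum => i _.
have [aui [uvi vib]] := uv i.
rewrite prim_sub// /I -(@integral_itv_bndoo _ (u i) (v i) _ true false); last first.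
  by apply/measurable_EFinP; exact: measurable_funS mgab.
have guv : mu.-integrable `[u i, v i] (EFin \o g) by exact: locint_itv.
apply: (@le_trans _ _ (\int[mu]_(t in `[u i, v i]) `|g t|)%:E).
  by rewrite lee_fin; apply: le_normr_Rintegral.
rewrite fineK; last first.
  by apply: integrable_fin_num => //; exact: (integrable_norm guv).
rewrite le_eqVlt; apply/orP; left; apply/eqP; apply: eq_integral => x.
rewrite inE/= in_itv/= => /andP[ux xv]; rewrite /gab patchE mem_set//=.
by rewrite in_itv/= (le_trans aui)//= (le_trans xv).
Qed.

(** Lebesgue's differentiation theorem; near x the primitive agrees up to a
constant with the integral starting from x - 1. *)
Lemma prim_derivable g : locally_integrable setT g ->
  {ae mu, forall x, derivable (prim g) x 1 /\ derive1 (prim g) x = g x}.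
Proof.
move=> lg; move: (lg) => /lebesgue_differentiation.
apply: filterS; first exact: (ae_filter_ringOfSetsType mu).
move=> x gx.
pose F (y : R) := \int[mu]_(t in `[x - 1, y]) g t.
have [|||dF F'] := @FTC1_lebesgue_pt R g (BLeft (x - 1)) x (x + 1) _ _ _ gx.
- by rewrite ltrDl.
- exact: locint_itv.
- by rewrite lte_fin; lra.
have pF : \forall t \near x, cst (prim g (x - 1)) t + F t = prim g t.
  near=> t; rewrite /F -prim_sub//; first by rewrite [LHS]addrC subrK.
  by apply: ltW; near: t; apply: lt_nbhsr; lra.
have dF1 : is_derive x 1 F (g x).
  by apply: (DeriveDef dF); rewrite -derive1E.
have [d1 d2] := near_eq_is_derive pF
  (is_deriveD (is_derive_cst (prim g (x - 1)) x 1) dF1).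
by split; [exact: d1|rewrite derive1E d2 add0r].
Unshelve. all: by end_near. Qed.

End primitive.

(** * The linear equation y' = phi y - psi *)

Section linear_ode.
Context {R : realType}.
Local Notation mu := (@lebesgue_measure R).
Context (phi psi : R -> R) (lphi : locally_integrable setT phi)
  (lpsi : locally_integrable setT psi).
Local Notation Q := (prim phi).

Lemma prim_continuous (g : R -> R) : locally_integrable setT g -> continuous (prim g).
Proof. by move=> lg; apply: ac_cont => a b; exact: prim_ac. Qed.

Lemma damp_continuous : continuous (fun x => expR (- Q x)).
Proof.
move=> x; apply: continuous_comp; last exact: continuous_expR.
by apply: continuousN; exact: prim_continuous.
Qed.

Lemma damp_locint : locally_integrable setT (fun x => expR (- Q x) * psi x).
Proof. by apply: locint_cM => //; exact: damp_continuous. Qed.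

Lemma is_derive_damp (s x : R) :
  derivable Q x 1 /\ derive1 Q x = phi x ->
  is_derive x 1 (fun t => expR (s * Q t)) (expR (s * Q x) * (s * phi x)).
Proof.
move=> [dQ Q'].
have h : is_derive x 1 Q (phi x) by apply: (DeriveDef dQ); rewrite -derive1E.
have h2 : is_derive x 1 (s *: Q) (s *: phi x) by exact: is_deriveZ.
exact: (@is_derive1_comp _ _ _ _ _ _ (is_derive_expR _) h2).
Qed.

(** The function e^{-Q} y + \int e^{-Q} psi is absolutely continuous with
derivative zero almost everywhere. *)
Lemma linear_ode_repr (y : R -> R) :
  (forall a b, abs_continuous a b y) ->
  {ae mu, forall x : R, is_derive x 1 y (phi x * y x - psi x)} ->
  forall a b, a <= b ->
  expR (- Q a) * y a - expR (- Q b) * y b =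
    \int[mu]_(t in `[a, b]) (expR (- Q t) * psi t).
Proof.
move=> acy dy a b ab.
pose P := prim (fun x => expR (- Q x) * psi x).
pose E t := expR (-1 * Q t).
pose z := E * y + P.
have acz : abs_continuous a b z.
  apply: acD; last exact: prim_ac damp_locint.
  apply: acM => //; apply: ac_expR; apply: acM; [exact: ac_cst|exact: prim_ac].
have dz : {ae mu, forall x, derivable z x 1 /\ derive1 z x = 0}.
  have := prim_derivable lphi; have := prim_derivable damp_locint; move: dy.
  apply: filterS3; first exact: (ae_filter_ringOfSetsType mu).
  move=> x dyx [dP P'] dQ.
  have h1 : is_derive x 1 P (expR (- Q x) * psi x).
    by apply: (DeriveDef dP); rewrite -derive1E.
  have [d1 d2] := is_deriveD (is_deriveM (is_derive_damp (-1) dQ) dyx) h1.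
  split; [exact: d1|rewrite derive1E d2 /=].
  rewrite /= /GRing.scale/= !mulN1r; ring.
have := ac_null_derivative_cst ab acz dz.
rewrite -prim_sub//; last exact: damp_locint.
rewrite -/P /z /E /=.
have -> : (E * y + P) a = expR (- Q a) * y a + P a by rewrite /E -[- Q a]mulN1r.
have -> : (E * y + P) b = expR (- Q b) * y b + P b by rewrite /E -[- Q b]mulN1r.
have H (p q r s : R) : p + q = r + s -> p - r = s - q by lra.
exact: H.
Qed.

Lemma linear_ode_solves (K : R) (y : R -> R) :
  (forall x, y x = expR (Q x) * (K - prim (fun x => expR (- Q x) * psi x) x)) ->
  (forall a b, abs_continuous a b y) /\
  {ae mu, forall x : R, is_derive x 1 y (phi x * y x - psi x)}.
Proof.
move=> yE.
pose P := prim (fun x => expR (- Q x) * psi x).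
pose E t := expR (1 * Q t).
have {}yE : y = E * (cst K - P) by apply/funext => x; rewrite yE /E/= -[X in expR X]mul1r.
split=> [a b|].
  rewrite yE; apply: acM.
    apply: ac_expR; apply: acM; [exact: ac_cst|exact: prim_ac].
  apply: (ac_lip ler01 (prim_ac a b damp_locint) (ac_cst a b 0)) => u v _ _ _.
  have -> : (cst K - P) v - (cst K - P) u = - (P v - P u).
    have H (r s : R) : (K - r) - (K - s) = - (r - s) by ring.
    exact: H.
  by rewrite subrr normr0 addr0 mul1r normrN.
have := prim_derivable lphi; have := prim_derivable damp_locint.
apply: filterS2; first exact: (ae_filter_ringOfSetsType mu).
move=> x [dP P'] dQ.
have h1 : is_derive x 1 P (expR (- Q x) * psi x).
  by apply: (DeriveDef dP); rewrite -derive1E.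
have h2 := is_deriveM (is_derive_damp 1 dQ) (is_deriveB (is_derive_cst K x 1) h1).
have [d1 d2] := h2; rewrite yE; apply: (DeriveDef d1); rewrite d2.
rewrite /= /GRing.scale/= !mul1r.
have -> : (E * (cst K - P)) x = expR (Q x) * (K - P x) by rewrite /E -[X in expR X]mul1r.
have e : expR (Q x) * expR (- Q x) = 1 by rewrite -expRD subrr expR0.
have -> : (cst K - P) x = K - P x by [].
have H (s t v u c : R) : s * t = 1 ->
  s * (0 - t * c) + u * (s * v) = v * (s * u) - c.
  by move=> st; rewrite (_ : s * (0 - t * c) = - (s * t * c)); [rewrite st; ring|ring].
exact: H e.
Qed.

End linear_ode.

(** * Mass of an exponentially damped weight *)

Section kernel_mass.
Context {R : realType}.
Local Notation mu := (@lebesgue_measure R).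

Lemma ge0_integral_itvy_le (h : R -> \bar R) (x : R) (M : \bar R) :
  measurable_fun setT h -> (forall t, (0 <= h t)%E) ->
  (forall T, (\int[mu]_(t in `[x, T]) h t <= M)%E) ->
  (\int[mu]_(t in `[x, +oo[) h t <= M)%E.
Proof.
move=> mh h0 hM.
rewrite itv_bndy_bigcup_BRight.
have ndI : nondecreasing_seq (fun n : nat => `[x, x + n%:R]%classic : set R).
  by move=> n m nm; apply/subsetPset; apply: subset_itvl; rewrite bnd_simp lerD2l ler_nat.
have cv : (\int[mu]_(t in `[x, (x + n%:R)%R]) h t)%E @[n --> \oo] -->
    (\int[mu]_(t in \bigcup_n `[x, (x + n%:R)%R]%classic) h t)%E.
  apply: ge0_nondecreasing_set_cvg_integral => // n.
  exact: measurable_funTS.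
rewrite -(cvg_lim _ cv)//; apply: lime_le; first by apply: cvgP cv.
by near=> n; exact: hM.
Unshelve. all: by end_near. Qed.

Lemma ge0_integral_reflect (h : R -> \bar R) (x : R) :
  measurable_fun setT h -> (forall t, (0 <= h t)%E) ->
  (\int[mu]_(t in `]-oo, x]) h t = \int[mu]_(t in `[(- x)%R, +oo[) h (- t)%R)%E.
Proof.
move=> mh h0.
pose k t := h (- t)%R.
have mk : measurable_fun setT k by exact: measurableT_comp.
have -> : `]-oo, x]%classic = (-%R : R -> measurableTypeR R) @^-1` `[(- x)%R, +oo[%classic.
  by rewrite opp_preimage_itvbndy opprK.
rewrite [LHS](_ : _ = \int[mu]_(t in (-%R : R -> measurableTypeR R) @^-1` `[(- x)%R, +oo[%classic) (k \o -%R) t)%E; last first.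
  by apply: eq_integral => t _; rewrite /k /= opprK.
rewrite -ge0_integral_pushforward//=; first last.
- by move=> t _; exact: h0.
- exact: measurable_funTS mk.
by apply: eq_measure_integral => //= A mA AS; exact: lebesgue_measureN.
Qed.

Lemma expRN2_le : expR (- 2) <= 1 / 2 :> R.
Proof.
rewrite expRN div1r lef_pV2 ?posrE ?expR_gt0//.
by apply: le_trans (expR_ge1Dx _); lra.
Qed.

Section right.
Context (Q : R -> R) (cQ : continuous Q) (ndQ : {homo Q : x y / x <= y}).
Context (g : R -> R) (mg : measurable_fun setT g) (g0 : forall t, 0 <= g t).
Context (M : R) (stepQ : forall x, exists v, [/\ x <= v, Q v = Q x + 2 &
  (\int[mu]_(t in `[x, v]) (g t)%:E <= M%:E)%E]).

Let K x t := (expR (- (Q t - Q x)) * g t)%:E.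

Lemma measurable_damped x : measurable_fun setT (K x).
Proof.
apply/measurable_EFinP/measurable_funM => //.
apply: continuous_measurable_fun => t.
apply: continuous_comp; last exact: continuous_expR.
by apply: continuousN; apply: continuousB; [exact: cQ|exact: cvg_cst].
Qed.

Let K0 x t : (0 <= K x t)%E.
Proof. by rewrite lee_fin mulr_ge0// expR_ge0. Qed.

Let Kle x t : x <= t -> (K x t <= (g t)%:E)%E.
Proof.
move=> xt; rewrite lee_fin ler_piMl// -expR0 ler_expR oppr_le0 subr_ge0; exact: ndQ.
Qed.

Let first_step x v T : T <= v -> (\int[mu]_(t in `[x, v]) (g t)%:E <= M%:E)%E ->
  (\int[mu]_(t in `[x, T]) K x t <= M%:E)%E.
Proof.
move=> Tv; apply: le_trans.
apply: (@le_trans _ _ (\int[mu]_(t in `[x, v]) K x t)%E).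
  apply: ge0_subset_integral => //.
    exact: measurable_funTS (measurable_damped x).
  by apply: subset_itvl; rewrite bnd_simp.
apply: ge0_le_integral => //.
- exact: measurable_funTS (measurable_damped x).
- by apply: measurable_funTS; exact/measurable_EFinP.
- by move=> t /=; rewrite in_itv/= => /andP[xt _]; exact: Kle.
Qed.

Let stepM_ge0 : 0 <= M.
Proof.
have [v [_ _ h]] := stepQ 0; rewrite -lee_fin; apply: le_trans h.
by apply: integral_ge0 => t _; rewrite lee_fin.
Qed.

(** Induction on the number of windows: the first one contributes at most M, and
beyond it the weight carries an extra factor e^{-2} <= 1/2, so the rest
contributes at most half of 2 M. *)
Lemma kernel_mass_bounded n x T : Q T <= Q x + 2 * n%:R ->
  (\int[mu]_(t in `[x, T]) K x t <= (2 * M)%:E)%E.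
Proof.
elim: n x T => [|n IH] x T QT.
  have [v [xv Qv gv]] := stepQ x.
  have Tv : T <= v by rewrite leNgt; apply/negP => /ltW/ndQ; lra.
  apply: le_trans (first_step Tv gv) _; rewrite lee_fin; have := stepM_ge0; lra.
have [v [xv Qv gv]] := stepQ x.
have [Tv|vT] := leP T v.
  apply: le_trans (first_step Tv gv) _; rewrite lee_fin; have := stepM_ge0; lra.
rewrite (@itv_bndbnd_setU _ _ _ (BRight v)) ?bnd_simp ?(ltW vT)//.
rewrite ge0_integral_setU//; first last.
- rewrite disj_set2E; apply/eqP; rewrite -subset0 => t /= []; rewrite !in_itv/=.
  by move=> /andP[_ tv] /andP[]; rewrite ltNge tv.
- exact: measurable_funTS (measurable_damped x).
have -> : (2 * M = M + M)%R by ring.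
rewrite EFinD; apply: leeD; first exact: first_step gv.
rewrite integral_itv_obnd_cbnd; last exact: measurable_funTS (measurable_damped x).
rewrite [leLHS](_ : _ = (\int[mu]_(t in `[v, T]) ((expR (- 2))%:E * K v t))%E); last first.
  apply: eq_integral => t _; rewrite /K -EFinM mulrA -expRD Qv; congr (expR _ * _)%:E; ring.
rewrite ge0_integralZl ?lee_fin ?expR_ge0//; last first.
  exact: measurable_funTS (measurable_damped v).
have {}IH : (\int[mu]_(t in `[v, T]) K v t <= (2 * M)%:E)%E.
  by apply: IH; move: QT; rewrite Qv -natr1; lra.
apply: (@le_trans _ _ ((expR (- 2))%:E * (2 * M)%:E)%E).
  by apply: lee_wpmul2l => //; rewrite lee_fin expR_ge0.
rewrite -EFinM lee_fin; apply: (@le_trans _ _ (1 / 2 * (2 * M))); last by lra.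
by rewrite ler_wpM2r// ?expRN2_le// mulr_ge0// stepM_ge0.
Qed.

Lemma kernel_mass_right x :
  (\int[mu]_(t in `[x, +oo[) (expR (- (Q t - Q x)) * g t)%:E <= (2 * M)%:E)%E.
Proof.
apply: ge0_integral_itvy_le; [exact: measurable_damped|exact: K0|move=> T].
have hn : Q T <= Q x + 2 * (Num.bound `|Q T - Q x|)%:R.
  have : Q T - Q x < (Num.bound `|Q T - Q x|)%:R.
    by apply: le_lt_trans (ler_norm _) _; exact: archi_boundP.
  have : 0 <= (Num.bound `|Q T - Q x|)%:R :> R by [].
  lra.
exact: kernel_mass_bounded hn.
Qed.

End right.

(** The reflection t |-> - t turns Q into the nondecreasing function - Q(-t) and
reduces the claim to kernel_mass_right with g = 1. *)
Lemma kernel_mass_left (Q : R -> R) (M : R) : continuous Q ->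
  {homo Q : x y / x <= y} ->
  (forall x, exists u, [/\ u <= x, Q u = Q x - 2 & x - u <= M]) -> forall x,
  (\int[mu]_(t in `]-oo, x]) (expR (- (Q x - Q t)))%:E <= (2 * M)%:E)%E.
Proof.
move=> cQ ndQ stepQ x.
rewrite ge0_integral_reflect; first last.
- by move=> t; rewrite lee_fin expR_ge0.
- apply/measurable_EFinP; apply: continuous_measurable_fun => t.
  apply: continuous_comp; last exact: continuous_expR.
  by apply: continuousN; apply: continuousB; [exact: cvg_cst|exact: cQ].
pose Q' t := - Q (- t).
have cQ' : continuous Q'.
  move=> t; apply: continuousN; apply: continuous_comp; last exact: cQ.
  exact: opp_continuous.
have ndQ' : {homo Q' : x y / x <= y} by move=> s t st; rewrite lerN2 ndQ// lerN2.
have step' z : exists v, [/\ z <= v, Q' v = Q' z + 2 &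
    (\int[mu]_(t in `[z, v]) (cst (1 : R) t)%:E <= M%:E)%E].
  have [u [uz Qu zu]] := stepQ (- z); exists (- u); split.
  - by rewrite lerNr.
  - by rewrite /Q' opprK Qu; ring.
  - have -> : (\int[mu]_(t in `[z, (- u)%R]) (cst (1 : R) t)%:E = mu `[z, (- u)%R])%E.
      by rewrite -[RHS]mul1e -integral_cst.
    rewrite lebesgue_measure_itv/=.
    by case: ifPn => _; rewrite lee_fin; lra.
have := kernel_mass_right cQ' ndQ' (measurable_cst _) (fun=> ler01) step' (- x).
apply: le_trans; rewrite le_eqVlt; apply/orP; left; apply/eqP.
apply: eq_integral => t _; rewrite /Q' /cst mulr1 (opprK x); congr (expR _)%:E; ring.
Qed.

End kernel_mass.

(** * The phase and the windows of phase two *)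

Section first_hit.
Context {R : realType}.

(** The level set is closed, so it contains its infimum. *)
Lemma first_hit (F : R -> R) (c a w : R) : continuous F -> a <= w -> F w = c ->
  exists v, [/\ a <= v, v <= w, F v = c & forall u, a <= u < v -> F u <> c].
Proof.
move=> cF aw Fw.
pose S := [set u | a <= u /\ F u = c].
have lS : has_lbound S by exists a => u [].
have hS : has_inf S by split => //; exists w.
have av : a <= inf S by apply: lb_le_inf; [exists w|move=> u []].
exists (inf S); split => //.
- exact: ge_inf.
- apply/eqP/negPn/negP => /eqP Fv.
  have e0 : 0 < `|F (inf S) - c| by rewrite normr_gt0 subr_eq0; apply/eqP.
  have /cvgrPdist_lt/(_ _ e0)/nbhs_ballP[d /= d0 dP] := cF (inf S).
  have [u [au Fu] ud] := inf_adherent d0 hS.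
  have vu : inf S <= u by exact: ge_inf.
  have h : `|inf S - u| < d by rewrite distrC ger0_norm ?subr_ge0//; lra.
  by have := dP u h; rewrite /= Fu ltxx.
- move=> u /andP[au uv] Fu; have : inf S <= u by exact: ge_inf.
  by rewrite leNgt uv.
Qed.

Lemma IVT_increasing_range (F : R -> R) (a b c : R) : continuous F -> a <= b ->
  F a <= c -> c <= F b -> exists2 w, a <= w <= b & F w = c.
Proof.
move=> cF ab Fa Fb.
have [||w] := @IVT R F a b c ab.
- exact: continuous_subspaceT.
- by rewrite ge_min Fa/= le_max Fb orbT.
- by rewrite in_itv/= => wab Fw; exists w.
Qed.

End first_hit.

Section otelbaev.
Context {R : realType}.
Local Notation mu := (@lebesgue_measure R).
Context (r q : R -> R) (cr : continuous r) (r0 : forall x, 0 < r x)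
  (lq : locally_integrable setT q) (q0 : {ae mu, forall x : R, 0 <= q x}).

Definition qr_phase : R -> R := prim (fun t => q t / r t).
Local Notation Q := qr_phase.

Lemma continuousV_pos : continuous (fun x => (r x)^-1).
Proof. by move=> x; apply: continuousV; [rewrite gt_eqF|exact: cr]. Qed.

Lemma locint_divr (f : R -> R) : locally_integrable setT f ->
  locally_integrable setT (fun t => f t / r t).
Proof.
move=> lf; under [X in locally_integrable _ X]eq_fun do rewrite mulrC.
by apply: locint_cM => //; exact: continuousV_pos.
Qed.

Lemma phase_continuous : continuous Q.
Proof. by apply: prim_continuous; exact: locint_divr. Qed.

Lemma phaseB (a b : R) : a <= b ->
  Q b - Q a = \int[mu]_(t in `[a, b]) (q t / r t).
Proof. by move=> ab; rewrite /Q prim_sub//; exact: locint_divr. Qed.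

Lemma phase_nondecreasing : {homo Q : x y / x <= y}.
Proof.
move=> x y xy; rewrite -subr_ge0 phaseB// /Rintegral fine_ge0//.
have iqr := locint_itv x y (locint_divr lq).
rewrite (@ae_eq_integral _ _ _ mu `[x, y]%classic (fun t => `|(q t / r t)%:E|)%E)//.
- by apply: integral_ge0.
- by case/integrableP : iqr.
- by apply: measurableT_comp => //; case/integrableP : iqr.
- move: q0; apply: filterS; first exact: (ae_filter_ringOfSetsType mu).
  by move=> t qt _; rewrite gee0_abs// lee_fin divr_ge0// ltW.
Qed.

Lemma qr_integralE (x d : R) : 0 <= d ->
  qr_integral r q x d = (Q (x + d) - Q (x - d))%:E.
Proof.
move=> d0; rewrite phaseB; last by lra.
rewrite /qr_integral /Rintegral fineK//; apply: integrable_fin_num => //.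
exact: locint_itv (locint_divr lq).
Qed.

Context (mass_at_scale : exists2 a : R, 0 < a &
  (0 < ereal_inf (range (fun x : R => qr_integral r q x a)))%E).

(** Chaining n windows of radius a raises Q by n times their minimal mass. *)
Lemma phase_growth : exists2 D : R, 0 < D & forall x, Q x + 2 <= Q (x + D).
Proof.
have [a a0 H] := mass_at_scale.
have [m m0 Hm] : exists2 m : R, 0 < m & forall x, m <= Q (x + a) - Q (x - a).
  have Hx x : (ereal_inf (range (fun x : R => qr_integral r q x a)) <=
      (Q (x + a) - Q (x - a))%:E)%E.
    by rewrite -qr_integralE ?(ltW a0)//; apply: ereal_inf_lbound; exists x.
  case: (ereal_inf _) H Hx => [m m0 Hx| _ Hx|//].
    by exists m => // x; rewrite -lee_fin.
  by have := Hx 0; rewrite leye_eq.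
have Hn n x : Q x + m * n%:R <= Q (x + 2 * a * n%:R).
  elim: n => [|n IH]; first by rewrite !mulr0 !addr0.
  have := Hm (x + 2 * a * n%:R + a).
  rewrite addrK.
  have -> : m * n.+1%:R = m * n%:R + m by rewrite -natr1; ring.
  have -> : x + 2 * a * n.+1%:R = x + 2 * a * n%:R + a + a by rewrite -natr1; ring.
  by lra.
pose n := (Num.bound (2 / m)).+1.
exists (2 * a * n%:R); first by rewrite !mulr_gt0.
move=> x; apply: le_trans (Hn n x); rewrite lerD2l.
rewrite -ler_pdivrMl// mulrC ltW//.
apply: (@lt_trans _ _ (Num.bound (2 / m))%:R); last by rewrite ltr_nat.
by apply: archi_boundP; rewrite divr_ge0// ltW.
Qed.

Lemma d_funE (x d : R) : 0 < d -> Q (x + d) - Q (x - d) = 2 ->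
  (forall u, 0 < u < d -> Q (x + u) - Q (x - u) <> 2) -> d_fun r q x = d.
Proof.
move=> d0 Qd dmin; rewrite /d_fun; set S := (X in inf X).
have Sd : S d by split => //; rewrite qr_integralE ?(ltW d0)// Qd.
apply/eqP; rewrite eq_le; apply/andP; split.
  by apply: ge_inf => //; exists 0 => u [/ltW].
apply: lb_le_inf; first by exists d.
move=> u [u0]; rewrite qr_integralE ?(ltW u0)// => -[Qu].
by rewrite leNgt; apply/negP => ud; apply: (dmin u) => //; rewrite u0.
Qed.

Lemma d_fun_spec (D : R) : 0 < D -> (forall x, Q x + 2 <= Q (x + D)) ->
  forall x, [/\ 0 < d_fun r q x, d_fun r q x <= D &
    Q (x + d_fun r q x) - Q (x - d_fun r q x) = 2].
Proof.
move=> D0 HD x.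
pose F d := Q (x + d) - Q (x - d).
have cF : continuous F.
  move=> d; rewrite /F; apply: cvgB.
    apply: continuous_comp; last exact: phase_continuous.
    by apply: continuousD; [exact: cvg_cst|exact: cvg_id].
  apply: (@continuous_comp _ _ _ (fun t : R => x - t) Q d); last exact: phase_continuous.
  by apply: cvgB; [exact: cvg_cst|exact: cvg_id].
have F0 : F 0 <= 2 by rewrite /F addr0 subr0 subrr.
have FD : 2 <= F D.
  have := HD x; have : Q (x - D) <= Q x by apply: phase_nondecreasing; lra.
  rewrite /F; lra.
have [w /andP[w0 wD] Fw] := IVT_increasing_range cF (ltW D0) F0 FD.
have [v [v0 vw Fv vmin]] := first_hit cF w0 Fw.
have v0' : 0 < v.
  rewrite lt_neqAle v0 andbT; apply/eqP => v00.
  by move: Fv; rewrite -v00 /F addr0 subr0 subrr; lra.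
have dv : d_fun r q x = v.
  by apply: d_funE => // u /andP[u0 uv]; apply: vmin; rewrite ltW.
by rewrite dv; split => //; exact: le_trans wD.
Qed.

(** Two endpoints with phase difference 2 form the window of their midpoint as
soon as no strictly smaller interval has phase difference 2; without this, q could
vanish near the endpoints and d at the midpoint would be smaller. *)
Lemma d_fun_step (u v : R) : u < v -> Q v - Q u = 2 ->
  (forall s t, u < s -> s <= t -> t < v -> Q t - Q s <> 2) ->
  d_fun r q ((u + v) / 2) = (v - u) / 2.
Proof.
move=> uv Quv H; apply: d_funE.
- by lra.
- by rewrite -[RHS]Quv; congr (Q _ - Q _); lra.
- by move=> w /andP[w0 wv]; apply: H; lra.
Qed.

(** The endpoint v is the first point where Q has grown by 2. This minimality
makes [x, v] a window, although q may vanish to the right of x. *)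
Lemma step_right x : exists v, [/\ x < v, Q v = Q x + 2 &
  d_fun r q ((x + v) / 2) = (v - x) / 2].
Proof.
have [D D0 HD] := phase_growth.
have xD : x <= x + D by lra.
have Q2 : Q x <= Q x + 2 by lra.
have [w /andP[xw _] Qw] := IVT_increasing_range phase_continuous xD Q2 (HD x).
have [v [xv _ Qv vmin]] := first_hit phase_continuous xw Qw.
have xv' : x < v.
  by rewrite lt_neqAle xv andbT; apply/eqP => xv'; move: Qv; rewrite -xv'; lra.
exists v; split => //; apply: d_fun_step => //; first by rewrite Qv; ring.
move=> s t xs st tv Qts.
have := phase_nondecreasing (ltW xs); have := phase_nondecreasing (ltW tv) => h1 h2.
by apply: (vmin t); [rewrite tv andbT; lra|lra].
Qed.

Lemma step_left x : exists u, [/\ u < x, Q u = Q x - 2 &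
  d_fun r q ((u + x) / 2) = (x - u) / 2].
Proof.
have [D D0 HD] := phase_growth.
pose F t := - Q (x - t).
have cF : continuous F.
  move=> t; apply: cvgN.
  apply: (@continuous_comp _ _ _ (fun t : R => x - t) Q t); last exact: phase_continuous.
  by apply: cvgB; [exact: cvg_cst|exact: cvg_id].
have F0 : F 0 <= 2 - Q x by rewrite /F subr0; lra.
have FD : 2 - Q x <= F D by have := HD (x - D); rewrite /F subrK; lra.
have [w /andP[w0 _] Fw] := IVT_increasing_range cF (ltW D0) F0 FD.
have [v [v0 _ Fv vmin]] := first_hit cF w0 Fw.
have v0' : 0 < v.
  rewrite lt_neqAle v0 andbT; apply/eqP => v00.
  by move: Fv; rewrite -v00 /F subr0; lra.
have Qu : Q (x - v) = Q x - 2 by move: Fv; rewrite /F; lra.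
exists (x - v); split => //; first by lra.
apply: d_fun_step; [by lra|by rewrite Qu; ring|].
move=> s t us st tx Qts.
have := phase_nondecreasing (ltW us); have := phase_nondecreasing (ltW tx) => h1 h2.
apply: (vmin (x - s)); first by apply/andP; split; lra.
by rewrite /F (_ : x - (x - s) = s); [lra|ring].
Qed.

Lemma d_sup_bounds : exists2 d0 : R, 0 < d0 & d_sup r q = d0%:E.
Proof.
have [D D0 HD] := phase_growth.
have hd := d_fun_spec D0 HD.
have leD : (d_sup r q <= D%:E)%E.
  by apply: ge_ereal_sup => _ [x _ <-]; rewrite lee_fin; have [] := hd x.
have ge0 : ((d_fun r q 0)%:E <= d_sup r q)%E by apply: ereal_sup_ubound; exists 0.
have [d00 _ _] := hd 0.
case: (d_sup r q) leD ge0 => [s|//|//] _; rewrite lee_fin => h.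
by exists s => //; exact: lt_le_trans h.
Qed.

End otelbaev.

(** * Hoelder and Tonelli for the damped weight *)

Section weighted_hoelder.
Context {R : realType}.
Local Notation mu := (@lebesgue_measure R).

Lemma powR_inv (a s : R) : 0 <= a -> (a^-1) `^ s = (a `^ s)^-1.
Proof. by move=> a0; rewrite -powR_inv1// -powRrM mulN1r powRN. Qed.

Lemma powRrK (a s : R) : 0 <= a -> s != 0 -> (a `^ s^-1) `^ s = a.
Proof. by move=> a0 s0; rewrite -powRrM mulVf// powRr1. Qed.

Lemma Lnorm_restrict (D : set R) (h : R -> R) (s : R) : measurable D -> 0 < s ->
  (forall t, 0 <= h t) ->
  ('N[mu]_(s%:E)[EFin \o (h \_ D)] =
   (\int[mu]_(t in D) (h t `^ s)%:E) `^ s^-1)%E.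
Proof.
move=> mD s0 h0; rewrite unlock.
rewrite [in RHS]integral_mkcond; congr (_ `^ _)%E; apply: eq_integral => t _.
rewrite /= !patchE; case: ifPn => _.
  by rewrite ger0_norm// poweR_EFin.
by rewrite normr0 powR0 ?gt_eqF.
Qed.

(** Hoelder's inequality for k^{1/p'} g and k^{1/p} |f|. *)
Lemma weighted_hoelder (D : set R) (k g f : R -> R) (p p' : R) : measurable D ->
  measurable_fun setT k -> measurable_fun setT g -> measurable_fun setT f ->
  (forall t, 0 <= k t) -> (forall t, 0 <= g t) -> 0 < p -> 0 < p' ->
  p^-1 + p'^-1 = 1 ->
  (\int[mu]_(t in D) (k t * g t * `|f t|)%:E <=
   (\int[mu]_(t in D) (k t * g t `^ p')%:E) `^ p'^-1 *
   (\int[mu]_(t in D) (k t * `|f t| `^ p)%:E) `^ p^-1)%E.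
Proof.
move=> mD mk mg mf k0 g0 p0 p'0 pp'.
pose F1 t := k t `^ p'^-1 * g t.
pose F2 t := k t `^ p^-1 * `|f t|.
have F10 t : 0 <= F1 t by rewrite mulr_ge0// powR_ge0.
have F20 t : 0 <= F2 t by rewrite mulr_ge0// powR_ge0.
have mF1 : measurable_fun setT F1.
  by apply: measurable_funM => //; exact: measurable_powR_comp.
have mF2 : measurable_fun setT F2.
  apply: measurable_funM; first exact: measurable_powR_comp.
  exact: measurableT_comp.
have mR h : measurable_fun setT h -> measurable_fun setT (h \_ D : R -> R).
  move=> mh.
  by apply/(measurable_restrictT _ _).1 => //; exact: measurable_funTS.
have p'p : p'^-1 + p^-1 = 1 by rewrite addrC.
have := hoelder mu (mR _ mF1) (mR _ mF2) p'0 p0 p'p.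
rewrite !Lnorm_restrict// Lnorm1.
have -> : (\int[mu]_t `|(EFin \o ((F1 \_ D) \* (F2 \_ D))%R) t| =
           \int[mu]_(t in D) (k t * g t * `|f t|)%:E)%E.
  rewrite [RHS]integral_mkcond; apply: eq_integral => t _.
  have F12 : F1 t * F2 t = k t * g t * `|f t|.
    by rewrite /F1 /F2 mulrACA -powRD p'p ?powRr1 ?oner_eq0// mulrA.
  rewrite /= !patchE; case: ifPn => _; last by rewrite mulr0 normr0.
  by rewrite F12 ger0_norm// !mulr_ge0.
move=> h; apply: le_trans h _.
rewrite le_eqVlt; apply/orP; left; apply/eqP; congr (_ `^ _ * _ `^ _)%E.
- apply: eq_integral => t _; congr (_%:E).
  by rewrite powRM ?powR_ge0// powRrK// gt_eqF.
- apply: eq_integral => t _; congr (_%:E).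
  by rewrite powRM ?powR_ge0// powRrK// gt_eqF.
Qed.

End weighted_hoelder.

Section tonelli.
Context {R : realType}.
Local Notation mu := (@lebesgue_measure R).

(** Both iterated integrals are those of the integrand cut off to x <= t. *)
Lemma damped_tonelli (Q h : R -> R) : continuous Q -> measurable_fun setT h ->
  (forall t, 0 <= h t) ->
  let W x := (\int[mu]_(t in `[x, +oo[) (expR (- (Q t - Q x)) * h t)%:E)%E in
  let V t := ((h t)%:E * \int[mu]_(x in `]-oo, t]) (expR (- (Q t - Q x)))%:E)%E in
  [/\ measurable_fun setT W, measurable_fun setT V &
   (\int[mu]_x W x = \int[mu]_t V t)%E].
Proof.
move=> cQ mh h0 W V.
have mQ : measurable_fun setT Q by exact: continuous_measurable_fun.
pose E := [set z : R * R | z.1 <= z.2].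
have mE : measurable E.
  rewrite -[E]setTI; apply: measurable_fun_le => //.
pose F (z : R * R) : \bar R :=
  (\1_E z * (expR (- (Q z.2 - Q z.1)) * h z.2))%:E.
have F0 z : (0 <= F z)%E by rewrite lee_fin !mulr_ge0// expR_ge0.
have mF : measurable_fun setT F.
  apply/measurable_EFinP/measurable_funM; first exact: measurable_indic.
  apply: measurable_funM; last by apply: measurableT_comp.
  apply: measurableT_comp => //; apply: measurableT_comp => //.
  by apply: measurable_funB; apply: measurableT_comp.
have WE : W = fubini_F mu F.
  apply/funext => x; rewrite /W /fubini_F [LHS]integral_mkcond; apply: eq_integral => t _.
  rewrite patchE /F indicE.
  case: ifPn; rewrite ?inE ?notin_setE/= in_itv/= andbT => xt.
    by rewrite mem_set// mul1r.
  by rewrite memNset ?mul0r.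
have VE : V = fubini_G mu F.
  apply/funext => t; rewrite /V /fubini_G [in LHS]integral_mkcond.
  rewrite -ge0_integralZl//; last 3 first.
  - apply/(measurable_restrictT _ _).1 => //; apply: measurable_funTS.
    apply: measurableT_comp => //; apply: measurableT_comp => //.
    by apply: measurableT_comp => //; exact: measurable_funB.
  - by move=> x _; rewrite erestrict_ge0// => ? _; rewrite lee_fin expR_ge0.
  - by rewrite lee_fin.
  apply: eq_integral => x _; rewrite patchE /F indicE.
  case: ifPn; rewrite ?inE ?notin_setE/= in_itv/= => xt.
    by rewrite mem_set// mul1r -EFinM mulrC.
  by rewrite memNset ?mul0r ?mule0.
split.
- by rewrite WE; exact: measurable_fun_fubini_tonelli_F.
- by rewrite VE; exact: measurable_fun_fubini_tonelli_G.
- by rewrite WE VE; exact: (@fubini_tonelli _ _ _ _ R mu mu F mF F0).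
Qed.

End tonelli.

(** * Pointwise bounds for the Green operator *)

Section green.
Context {R : realType}.
Local Notation mu := (@lebesgue_measure R).
Context (r q : R -> R) (cr : continuous r) (r0 : forall x, 0 < r x)
  (lq : locally_integrable setT q) (q0 : {ae mu, forall x : R, 0 <= q x})
  (mass_at_scale : exists2 a : R, 0 < a &
    (0 < ereal_inf (range (fun x : R => qr_integral r q x a)))%E).
Context (p : R) (p1 : 1 < p).
Local Notation Q := (qr_phase r q).
Local Notation p' := (p / (p - 1)).

Lemma conj_gt0 : 0 < p'.
Proof. by apply: divr_gt0; [exact: lt_trans p1|rewrite subr_gt0]. Qed.

Lemma conj_add : p^-1 + p'^-1 = 1.
Proof. by rewrite invf_div; field; rewrite gt_eqF// (lt_trans ltr01). Qed.

Let p0 : 0 < p. Proof. exact: lt_trans p1. Qed.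

Let cQ : continuous Q. Proof. exact: phase_continuous. Qed.
Let ndQ : {homo Q : x y / x <= y}. Proof. exact: phase_nondecreasing. Qed.

Lemma measurable_phase_kernel x : measurable_fun setT (fun t => expR (- (Q t - Q x))).
Proof.
apply: continuous_measurable_fun => t.
apply: continuous_comp; last exact: continuous_expR.
by apply: cvgN; apply: cvgB; [exact: cQ|exact: cvg_cst].
Qed.

Lemma measurableV_r : measurable_fun setT (fun t => (r t)^-1).
Proof. by apply: continuous_measurable_fun; exact: continuousV_pos. Qed.

Lemma phase_kernel_le1 x t : x <= t -> expR (- (Q t - Q x)) <= 1.
Proof. by move=> xt; rewrite -expR0 ler_expR oppr_le0 subr_ge0 ndQ. Qed.

Section bound.
Context (A : R) (hA : (A_sup r q p' <= A%:E)%E).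

Lemma A_ge0 : 0 <= A.
Proof.
rewrite -lee_fin; apply: le_trans hA; apply: ereal_sup_ge.
eexists; first by exists 0.
by apply: integral_ge0 => t _; rewrite lee_fin invr_ge0 powR_ge0.
Qed.

(** The windows given by step_right are among those in the definition of
A_sup. *)
Lemma kernel_mass_r x :
  (\int[mu]_(t in `[x, +oo[) (expR (- (Q t - Q x)) * (r t)^-1 `^ p')%:E
    <= (2 * A)%:E)%E.
Proof.
apply: (@kernel_mass_right _ Q cQ ndQ (fun t => (r t)^-1 `^ p')).
- by apply: measurable_powR_comp; exact: measurableV_r.
- by move=> t; exact: powR_ge0.
move=> z; have [v [zv Qv dv]] := step_right cr r0 lq q0 mass_at_scale z.
exists v; split => //; first exact: ltW.
apply: le_trans hA; apply: ereal_sup_ge; eexists; first by exists ((z + v) / 2).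
rewrite dv (_ : (z + v) / 2 - (v - z) / 2 = z); last by field.
rewrite (_ : (z + v) / 2 + (v - z) / 2 = v); last by field.
rewrite le_eqVlt; apply/orP; left; apply/eqP.
by apply: eq_integral => t _; rewrite powR_inv// ltW.
Qed.

End bound.

Lemma kernel_mass_len (d0 x : R) : (forall z, d_fun r q z <= d0) ->
  (\int[mu]_(t in `]-oo, x]) (expR (- (Q x - Q t)))%:E <= (2 * (2 * d0))%:E)%E.
Proof.
move=> hd; apply: kernel_mass_left => // z.
have [u [uz Qu du]] := step_left cr r0 lq q0 mass_at_scale z.
exists u; split => //; first exact: ltW.
by have := hd ((u + z) / 2); rewrite du; lra.
Qed.

Lemma G_integrandE f x t : x <= t ->
  G_integrand r q f x t = (r t)^-1 * expR (- (Q t - Q x)) * f t.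
Proof. by move=> xt; rewrite /G_integrand phaseB. Qed.

Section data.
Context (f : R -> R) (fp : f \in Lfun mu p%:E).

Let mf : measurable_fun setT f. Proof. exact: Lfun_measurable fp. Qed.

Let mfp : measurable_fun setT (fun t => `|f t| `^ p).
Proof. by apply: measurable_powR_comp; exact: measurableT_comp. Qed.

(** The factor of Hoelder's inequality that carries f in the estimate of G f(x),
written W(x) in the introduction. *)
Definition damped_power x : \bar R :=
  \int[mu]_(t in `[x, +oo[) (expR (- (Q t - Q x)) * `|f t| `^ p)%:E.
Local Notation W := damped_power.

Lemma damped_power_ge0 x : (0 <= W x)%E.
Proof.
by apply: integral_ge0 => t _; rewrite lee_fin mulr_ge0// ?expR_ge0// powR_ge0.
Qed.

Lemma damped_power_le x : (W x <= \int[mu]_(t in `[x, +oo[) (`|f t| `^ p)%:E)%E.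
Proof.
apply: ge0_le_integral => //.
- apply: measurable_funTS; apply/measurable_EFinP; apply: measurable_funM => //.
  exact: measurable_phase_kernel.
- by apply: measurable_funTS; apply/measurable_EFinP.
- move=> t /=; rewrite in_itv/= andbT => xt.
  by rewrite lee_fin ler_piMl ?powR_ge0// phase_kernel_le1.
Qed.

Lemma tail_power_le x : (\int[mu]_(t in `[x, +oo[) (`|f t| `^ p)%:E <=
  \int[mu]_t (`|f t| `^ p)%:E)%E.
Proof.
apply: ge0_subset_integral => //.
by apply/measurable_EFinP.
Qed.

Lemma damped_power_fin x : W x \is a fin_num.
Proof.
rewrite ge0_fin_numE ?damped_power_ge0//.
apply: le_lt_trans (Lfun_powR_lty p0 fp).
exact: le_trans (damped_power_le x) (tail_power_le x).
Qed.

Lemma damped_power_total (d0 : R) : (forall z, d_fun r q z <= d0) ->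
  measurable_fun setT W /\
  (\int[mu]_x W x <= (4 * d0)%:E * \int[mu]_t (`|f t| `^ p)%:E)%E.
Proof.
move=> hd.
have [mW mG ->] := damped_tonelli cQ mfp (fun t => powR_ge0 _ _).
split => //.
have d00 : 0 <= d0.
  have [D D0 HD] := phase_growth cr r0 lq mass_at_scale.
  have [h _ _] := d_fun_spec cr r0 lq q0 D0 HD 0.
  exact: le_trans (ltW h) (hd 0).
rewrite -ge0_integralZl ?lee_fin ?mulr_ge0//; last by apply/measurable_EFinP.
apply: ge0_le_integral => //.
- by move=> t _; rewrite mule_ge0 ?lee_fin ?powR_ge0// integral_ge0// => s _; rewrite lee_fin expR_ge0.
- by apply: measurable_funeM; apply/measurable_EFinP.
- move=> t _; rewrite muleC; apply: lee_wpmul2r; first by rewrite lee_fin powR_ge0.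
  apply: le_trans (kernel_mass_len t hd) _; rewrite lee_fin; lra.
Qed.

Section bounded.
Context (A : R) (hA : (A_sup r q p' <= A%:E)%E).

Lemma measurable_G_integrand (x : R) : measurable_fun `[x, +oo[ (G_integrand r q f x).
Proof.
apply: (eq_measurable_fun (fun t => (r t)^-1 * expR (- (Q t - Q x)) * f t)).
  by move=> t; rewrite inE/= in_itv/= andbT => xt; rewrite G_integrandE.
apply: measurable_funTS; apply: measurable_funM => //; apply: measurable_funM.
  exact: measurableV_r.
exact: measurable_phase_kernel.
Qed.

Lemma G_integrand_abs_le (x : R) :
  (\int[mu]_(t in `[x, +oo[) `|(G_integrand r q f x t)%:E| <=
   (2 * A)%:E `^ p'^-1 * W x `^ p^-1)%E.
Proof.
have rV0 t : 0 <= (r t)^-1 by rewrite invr_ge0 ltW.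
have h := weighted_hoelder (measurable_itv `[x, +oo[) (measurable_phase_kernel x)
  measurableV_r mf (fun=> expR_ge0 _) rV0 p0 conj_gt0 conj_add.
apply: le_trans (le_trans h _); last first.
rewrite lee_wpmul2r ?poweR_ge0// gt0_ler_poweR ?kernel_mass_r//.
  + by rewrite invr_ge0 ltW// conj_gt0.
  + by rewrite in_itv/= ?leey ?andbT integral_ge0// => t _; rewrite lee_fin mulr_ge0 ?expR_ge0 ?powR_ge0.
  + by rewrite in_itv/= ?leey ?andbT lee_fin mulr_ge0// A_ge0.
rewrite le_eqVlt; apply/orP; left; apply/eqP; apply: eq_integral => t.
rewrite inE/= in_itv/= andbT => xt; rewrite G_integrandE//= !normrM.
by rewrite ger0_norm ?invr_ge0 ?(ltW (r0 _))// ger0_norm ?expR_ge0// [X in X * _]mulrC.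
Qed.

Lemma G_integrand_integrable (x : R) :
  mu.-integrable `[x, +oo[ (EFin \o G_integrand r q f x).
Proof.
apply/integrableP; split.
  by apply/measurable_EFinP; exact: measurable_G_integrand.
apply: le_lt_trans (G_integrand_abs_le x) _.
rewrite ltey_eq fin_numM//; apply: fin_num_poweR => //.
exact: damped_power_fin.
Qed.

Lemma G_op_abs_le (x : R) :
  ((`|G_op r q f x|)%:E <= (2 * A)%:E `^ p'^-1 * W x `^ p^-1)%E.
Proof.
apply: le_trans (G_integrand_abs_le x).
have iG := G_integrand_integrable x.
apply: (@le_trans _ _ (\int[mu]_(t in `[x, +oo[) `|G_integrand r q f x t|)%:E).
  by rewrite lee_fin; apply: le_normr_Rintegral.
rewrite fineK//; apply: integrable_fin_num => //.
exact: (integrable_norm iG).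
Qed.

End bounded.
End data.
End green.

(** * Solutions of the problem *)

Section solutions.
Context {R : realType}.
Local Notation mu := (@lebesgue_measure R).
Context (r q : R -> R) (cr : continuous r) (r0 : forall x, 0 < r x)
  (lq : locally_integrable setT q).
Local Notation Q := (qr_phase r q).

Lemma solution_repr (f y : R -> R) (a b : R) : locally_integrable setT f ->
  is_solution r q f y -> a <= b ->
  expR (- Q a) * y a - expR (- Q b) * y b =
    \int[mu]_(t in `[a, b]) (expR (- Q t) * (f t / r t)).
Proof.
move=> lf [acy dy _ _] ab.
apply: (linear_ode_repr (locint_divr cr r0 lq) (locint_divr cr r0 lf)) => //.
move: dy; apply: filterS; first exact: (ae_filter_ringOfSetsType mu).
move=> x [dyx y'x]; apply: (DeriveDef dyx); rewrite -derive1E -y'x.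
by field; rewrite gt_eqF.
Qed.

Lemma repr_solution (f y : R -> R) (K : R) : locally_integrable setT f ->
  (forall x, y x = expR (Q x) *
     (K - prim (fun x => expR (- Q x) * (f x / r x)) x)) ->
  (forall a b, abs_continuous a b y) /\
  {ae mu, forall x : R, derivable y x 1 /\ - r x * derive1 y x + q x * y x = f x}.
Proof.
move=> lf yE.
have [acy dy] := linear_ode_solves (locint_divr cr r0 lq) (locint_divr cr r0 lf) yE.
split => //; move: dy; apply: filterS; first exact: (ae_filter_ringOfSetsType mu).
move=> x [dyx y'x]; split => //; rewrite derive1E y'x.
by field; rewrite gt_eqF.
Qed.

Context (q0 : {ae mu, forall x : R, 0 <= q x}).

(** The difference satisfies z(a) = e^{-(Q(b) - Q(a))} z(b) for all b >= a, hence
|z(a)| <= |z(b)|, which tends to 0. *)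
Lemma solution_unique (f y z : R -> R) : locally_integrable setT f ->
  is_solution r q f y -> is_solution r q f z -> y = z.
Proof.
move=> lf sy sz; apply/funext => a; apply/eqP; rewrite -subr_eq0 -normr_le0.
apply/ler_addgt0Pl => e e0; rewrite addr0.
have [_ _ _ yoo] := sy; have [_ _ _ zoo] := sz.
have yz : y x - z x @[x --> +oo] --> (0 : R).
  by rewrite -(subrr 0); exact: cvgB.
near (pinfty_nbhs R) => b.
have ab : a <= b by near: b; apply: nbhs_pinfty_ge; exact: num_real.
have yzb : `|y b - z b| < e.
  near: b; move/cvgrPdist_lt : yz => /(_ _ e0).
  by apply: filterS => b; rewrite sub0r normrN.
have H (s t u v w : R) : s * t - u * v = w -> forall t' v', s * t' - u * v' = w ->
    s * (t - t') = u * (v - v').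
  by move=> h1 t' v' h2; rewrite !mulrBr; lra.
have yza := H _ _ _ _ _ (solution_repr lf sy ab) _ _ (solution_repr lf sz ab).
have -> : y a - z a = expR (Q a - Q b) * (y b - z b).
  by rewrite expRD -mulrA -yza mulrA -expRD subrr expR0 mul1r.
rewrite normrM ger0_norm ?expR_ge0//; apply: le_trans (ltW yzb).
rewrite ler_piMl// -expR0 ler_expR subr_le0; exact: phase_nondecreasing.
Unshelve. all: by end_near. Qed.

End solutions.

Section tails.
Context {R : realType}.
Local Notation mu := (@lebesgue_measure R).

Lemma tails_small (h : R -> R) (e : R) : measurable_fun setT h ->
  (forall t, 0 <= h t) -> (\int[mu]_t (h t)%:E < +oo)%E -> 0 < e ->
  exists M : R, (\int[mu]_(t in ~` `[(- M)%R, M]) (h t)%:E <= e%:E)%E.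
Proof.
move=> mh h0 hoo e0.
pose F (n : nat) : set R := `[- n%:R, n%:R]%classic.
have mF n : measurable (F n) by exact: measurable_itv.
have FT : \bigcup_n F n = setT.
  apply/seteqP; split => // t _; exists (Num.bound `|t|) => //=.
  by rewrite /F/= in_itv/= -ler_norml; apply: ltW; exact: archi_boundP.
have mhE : measurable_fun setT (EFin \o h) by apply/measurable_EFinP.
have cv : (\int[mu]_(t in F n) (h t)%:E)%E @[n --> \oo] -->
    (\int[mu]_(t in \bigcup_n F n) (h t)%:E)%E.
  apply: ge0_nondecreasing_set_cvg_integral => //.
  - move=> n m nm; apply/subsetPset; apply: subset_itv; rewrite bnd_simp ?lerN2 ler_nat//.
  - by move=> n; exact: measurable_funTS.
  - by move=> n t _; rewrite lee_fin.
have tot_fin : (\int[mu]_t (h t)%:E \is a fin_num)%E.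
  by rewrite ge0_fin_numE// integral_ge0// => t _; rewrite lee_fin.
rewrite FT in cv.
have split_h n : (\int[mu]_t (h t)%:E = \int[mu]_(t in F n) (h t)%:E +
    \int[mu]_(t in ~` F n) (h t)%:E)%E.
  have mFc : measurable (~` F n) by exact: measurableC.
  rewrite -[X in integral _ X](setUv (F n)) ge0_integral_setU//.
  - exact: mF.
  - exact: measurable_funTS.
  - by move=> t _; rewrite lee_fin.
  - by rewrite disj_set2E setICr.
have [n Hn] : exists n, (\int[mu]_t (h t)%:E - e%:E < \int[mu]_(t in F n) (h t)%:E)%E.
  apply: contrapT => /forallNP H.
  have : (\int[mu]_t (h t)%:E <= \int[mu]_t (h t)%:E - e%:E)%E.
    apply: cvge_le cv; apply: nearW => n; rewrite leNgt; apply/negP; exact: H.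
  by rewrite leNgt lteBlDr// lteDl// lte_fin e0.
exists n%:R; move: Hn; rewrite (split_h n) -/(F n).
have fF : (\int[mu]_(t in F n) (h t)%:E \is a fin_num)%E.
  rewrite ge0_fin_numE; last by apply: integral_ge0 => t _; rewrite lee_fin.
  apply: le_lt_trans hoo; apply: ge0_subset_integral => //; first exact: mF.
  by move=> t _; rewrite lee_fin.
have fF' : (\int[mu]_(t in ~` F n) (h t)%:E \is a fin_num)%E.
  rewrite ge0_fin_numE; last by apply: integral_ge0 => t _; rewrite lee_fin.
  apply: le_lt_trans hoo; apply: ge0_subset_integral => //.
    by apply: measurableC; exact: mF.
  by move=> t _; rewrite lee_fin.
move: fF fF'; case: (integral _ _ _) => // s _; case: (integral _ _ _) => // t _.
by rewrite lteBlDr// -!EFinD lte_fin lee_fin => ?; lra.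
Qed.

End tails.

(** * The Green operator solves the problem *)

Section green_solves.
Context {R : realType}.
Local Notation mu := (@lebesgue_measure R).
Context (r q : R -> R) (cr : continuous r) (r0 : forall x, 0 < r x)
  (lq : locally_integrable setT q) (q0 : {ae mu, forall x : R, 0 <= q x})
  (mass_at_scale : exists2 a : R, 0 < a &
    (0 < ereal_inf (range (fun x : R => qr_integral r q x a)))%E).
Context (p : R) (p1 : 1 < p).
Local Notation Q := (qr_phase r q).
Local Notation p' := (p / (p - 1)).
Context (A : R) (hA : (A_sup r q p' <= A%:E)%E).
Context (f : R -> R) (fp : f \in Lfun mu p%:E).
Local Notation W := (damped_power r q p f).

Let p0 : 0 < p. Proof. exact: lt_trans p1. Qed.
Let lf : locally_integrable setT f. Proof. exact: Lfun_locint (ltW p1) fp. Qed.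
Let iG := G_integrand_integrable cr r0 lq q0 mass_at_scale p1 fp hA.

(** Pulling e^{Q(x)} out of the integral leaves the tail of a fixed integrable
function, which is a constant minus its primitive. *)
Lemma G_op_structure : exists K, forall x, G_op r q f x =
  expR (Q x) * (K - prim (fun t => expR (- Q t) * (f t / r t)) x).
Proof.
pose psi t := expR (- Q t) * (f t / r t).
have lpsi : locally_integrable setT psi.
  by apply: damp_locint; exact: locint_divr.
pose I (x : R) := \int[mu]_(t in `[x, +oo[) psi t.
have psiE x t : x <= t -> psi t = expR (- Q x) * G_integrand r q f x t.
  move=> xt; rewrite (G_integrandE cr r0 lq)// /psi.
  have -> : expR (- Q t) = expR (- Q x) * expR (- (Q t - Q x)).
    by rewrite -expRD; congr expR; ring.
  by ring.
have ipsi x : mu.-integrable `[x, +oo[ (EFin \o psi).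
  have h : mu.-integrable `[x, +oo[
      (fun t => (expR (- Q x))%:E * (EFin \o G_integrand r q f x) t)%E.
    by apply: integrableZl => //; exact: iG.
  apply: eq_integrable h => // t; rewrite inE/= in_itv/= andbT => xt.
  by rewrite /= (psiE x)// EFinM.
have GI x : G_op r q f x = expR (Q x) * I x.
  have -> : I x = expR (- Q x) * G_op r q f x.
    transitivity (\int[mu]_(t in `[x, +oo[) (expR (- Q x) * G_integrand r q f x t)).
      by apply: eq_Rintegral => t; rewrite inE/= in_itv/= andbT; exact: psiE.
    by apply: RintegralZl; [exact: measurable_itv|exact: iG].
  by rewrite mulrA -expRD subrr expR0 mul1r.
have Isub a b : a <= b -> I a + prim psi a = I b + prim psi b.
  move=> ab; have H := @Rintegral_itvB R psi (BLeft a) +oo%O b (ipsi a).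
  have {}H : I a - \int[mu]_(t in `[a, b]) psi t = I b.
    rewrite /I H ?bnd_simp// Rintegral_itv_obnd_cbnd//.
    apply: integrableS (ipsi b) => //; apply: subset_itvr; by rewrite bnd_simp.
  by rewrite -H -prim_sub//; ring.
exists (I 0 + prim psi 0) => x; rewrite GI; congr (_ * _).
by have [/Isub ->|/ltW/Isub <-] := leP 0 x; rewrite addrK.
Qed.

Lemma G_op_ode : (forall a b, abs_continuous a b (G_op r q f)) /\
  {ae mu, forall x : R, derivable (G_op r q f) x 1 /\
     - r x * derive1 (G_op r q f) x + q x * G_op r q f x = f x}.
Proof. by have [K GE] := G_op_structure; exact: repr_solution lf GE. Qed.

Lemma G_op_powR_le x :
  ((`|G_op r q f x| `^ p)%:E <= ((2 * A) `^ (p / p'))%:E * W x)%E.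
Proof.
have := G_op_abs_le cr r0 lq q0 mass_at_scale p1 fp hA x.
have := damped_power_fin cr r0 lq q0 p1 fp x.
have := damped_power_ge0 r q p f x.
case: (W x) => [w| |]//; rewrite lee_fin => w0 _.
have A0 := A_ge0 hA.
rewrite !poweR_EFin -EFinM !lee_fin => h.
apply: (@le_trans _ _ (((2 * A) `^ p'^-1 * w `^ p^-1) `^ p)).
  by apply: ge0_ler_powR; rewrite ?nnegrE ?(ltW p0)// mulr_ge0 ?powR_ge0.
rewrite powRM ?powR_ge0// -!powRrM mulVf ?gt_eqF// powRr1//.
by rewrite [p'^-1 * p]mulrC.
Qed.

Lemma G_op_measurable : measurable_fun setT (G_op r q f).
Proof.
by apply: continuous_measurable_fun; apply: ac_cont; case: G_op_ode.
Qed.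

Lemma G_op_power_total (d0 : R) : (forall z, d_fun r q z <= d0) ->
  (\int[mu]_x (`|G_op r q f x| `^ p)%:E <=
   ((2 * A) `^ (p / p') * (4 * d0))%:E * \int[mu]_t (`|f t| `^ p)%:E)%E.
Proof.
move=> hd.
have [mW Wle] := damped_power_total cr r0 lq q0 mass_at_scale fp hd.
have W0 x : (0 <= W x)%E by exact: damped_power_ge0.
apply: (@le_trans _ _ (\int[mu]_x (((2 * A) `^ (p / p'))%:E * W x))%E).
  apply: ge0_le_integral => //.
  - apply/measurable_EFinP; apply: measurable_powR_comp.
    by apply: measurableT_comp => //; exact: G_op_measurable.
  - exact: measurable_funeM.
  - by move=> x _; exact: G_op_powR_le.
rewrite ge0_integralZl ?lee_fin ?powR_ge0// EFinM -muleA.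
by rewrite lee_wpmul2l ?lee_fin ?powR_ge0.
Qed.

Lemma G_op_Lnorm (d0 : R) : (forall z, d_fun r q z <= d0) -> 0 <= d0 ->
  ('N[mu]_(p%:E)[EFin \o G_op r q f] <=
   ((2 * A) `^ p'^-1 * (4 * d0) `^ p^-1)%:E * 'N[mu]_(p%:E)[EFin \o f])%E.
Proof.
move=> hd d00; have A0 := A_ge0 hA; rewrite unlock /=.
have lift (g : R -> R) : (\int[mu]_x (`|(g x)%:E| `^ p) = \int[mu]_x (`|g x| `^ p)%:E)%E.
  by apply: eq_integral => x _; rewrite poweR_EFin.
rewrite !lift.
have -> : (((2 * A) `^ p'^-1 * (4 * d0) `^ p^-1)%:E =
    (((2 * A) `^ (p / p') * (4 * d0))%:E) `^ p^-1)%E.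
  have d40 : 0 <= 4 * d0 by rewrite mulr_ge0.
  rewrite poweR_EFin (powRM _ (powR_ge0 _ _) d40) -powRrM.
  by rewrite mulrAC mulfV ?gt_eqF// mul1r.
have If0 : (0 <= \int[mu]_x (`|f x| `^ p)%:E)%E.
  by apply: integral_ge0 => x _; rewrite lee_fin powR_ge0.
have c0 : (0 <= ((2 * A) `^ (p / p') * (4 * d0))%:E)%E.
  by rewrite lee_fin !mulr_ge0// powR_ge0.
rewrite -poweRM// gt0_ler_poweR ?invr_ge0 ?(ltW p0)//.
- by rewrite in_itv/= ?leey ?andbT integral_ge0// => x _; rewrite lee_fin powR_ge0.
- by rewrite in_itv/= ?leey ?andbT mule_ge0.
- exact: G_op_power_total.
Qed.

Lemma G_op_Lfun : G_op r q f \in Lfun mu p%:E.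
Proof.
have [d0 d00 dE] := d_sup_bounds cr r0 lq q0 mass_at_scale.
have hd z : d_fun r q z <= d0.
  by rewrite -lee_fin -dE; apply: ereal_sup_ubound; exists z.
rewrite inE/=; apply/andP; split.
  by rewrite inE; exact: G_op_measurable.
rewrite inE/= /finite_norm; apply: le_lt_trans (G_op_Lnorm hd (ltW d00)) _.
have : f \in finLfun mu p%:E by exact: sub_Lfun_finLfun fp.
rewrite inE/= /finite_norm => h.
by apply: lte_mul_pinfty; rewrite // lee_fin mulr_ge0// powR_ge0.
Qed.

Lemma G_op_small (e : R) : 0 < e -> exists2 d : R, 0 < d &
  forall x, (W x <= d%:E)%E -> `|G_op r q f x| < e.
Proof.
move=> e0.
pose C := (2 * A) `^ (p / p').
have C0 : 0 <= C by exact: powR_ge0.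
exists (e `^ p / (C + 1)); first by rewrite divr_gt0 ?powR_gt0//; lra.
move=> x Wx; rewrite ltNge; apply/negP => eG.
have h1 : `|G_op r q f x| `^ p <= C * (e `^ p / (C + 1)).
  rewrite -lee_fin; apply: le_trans (G_op_powR_le x) _; rewrite EFinM.
  by apply: lee_wpmul2l => //; rewrite lee_fin.
have h2 : e `^ p <= `|G_op r q f x| `^ p.
  by apply: ge0_ler_powR; rewrite ?nnegrE// ltW.
have e1 : 0 < e `^ p by exact: powR_gt0.
have := le_trans h2 h1.
rewrite leNgt mulrCA gtr_pMr// ltr_pdivrMr; first by rewrite mul1r ltrDl ltr01.
by lra.
Qed.

Lemma phase_ninfty (c : R) : exists X, forall x, x <= X -> Q x <= c.
Proof.
have [D D0 HD] := phase_growth cr r0 lq mass_at_scale.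
have H n : Q (- (D * n%:R)) <= Q 0 - 2 * n%:R.
  elim: n => [|n IH]; first by rewrite !mulr0 !oppr0 addr0.
  have := HD (- (D * n.+1%:R)).
  rewrite (_ : - (D * n.+1%:R) + D = - (D * n%:R)); last by rewrite -natr1; ring.
  have -> : 2 * n.+1%:R = 2 * n%:R + 2 :> R by rewrite -natr1; ring.
  by lra.
pose n := Num.bound `|Q 0 - c|.
exists (- (D * n%:R)) => x xX.
have := phase_nondecreasing cr r0 lq q0 xX.
have := H n; have : Q 0 - c < n%:R.
  by apply: le_lt_trans (ler_norm _) _; exact: archi_boundP.
have : 0 <= n%:R :> R by [].
lra.
Qed.

Let mfp : measurable_fun setT (fun t => `|f t| `^ p).
Proof.
by apply: measurable_powR_comp; apply: measurableT_comp => //; exact: Lfun_measurable fp.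
Qed.

Let fpoo := Lfun_powR_lty p0 fp.

Lemma G_op_cvg_pinfty : G_op r q f x @[x --> +oo] --> 0.
Proof.
apply/cvgrPdist_lt => e e0; have [d d0 Hd] := G_op_small e0.
have [M HM] := tails_small mfp (fun=> powR_ge0 _ _) fpoo d0.
near=> x; rewrite sub0r normrN; apply: Hd.
have Mx : M < x by near: x; apply: nbhs_pinfty_gt; exact: num_real.
apply: le_trans (damped_power_le cr r0 lq q0 fp x) _.
apply: le_trans HM; apply: ge0_subset_integral => //.
- by apply: measurableC.
- by apply: measurable_funTS; apply/measurable_EFinP.
- move=> t /=; rewrite !in_itv/= andbT => xt; apply/negP; rewrite negb_and.
  by rewrite -!ltNge (lt_le_trans Mx xt) orbT.
Unshelve. all: by end_near. Qed.

(** Up to T the weight is at most 1, beyond T it is at most its value at T. The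
second term vanishes as x tends to -oo for fixed T, the first one is small for T
close to -oo. *)
Lemma damped_power_split (T x : R) : x <= T ->
  (W x <= \int[mu]_(t in `]-oo, T]) (`|f t| `^ p)%:E +
    (expR (- (Q T - Q x)))%:E * \int[mu]_t (`|f t| `^ p)%:E)%E.
Proof.
move=> xT; rewrite /damped_power.
have mK : measurable_fun setT (fun t => (expR (- (Q t - Q x)) * `|f t| `^ p)%:E).
  apply/measurable_EFinP/measurable_funM => //.
  exact: measurable_phase_kernel.
have K0 t : (0 <= (expR (- (Q t - Q x)) * `|f t| `^ p)%:E)%E.
  by rewrite lee_fin mulr_ge0// ?expR_ge0 ?powR_ge0.
rewrite (@itv_bndbnd_setU _ _ _ (BRight T)) ?bnd_simp//.
rewrite ge0_integral_setU//; first last.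
- rewrite disj_set2E; apply/eqP; rewrite -subset0 => t /= []; rewrite !in_itv/= andbT.
  by move=> /andP[_ tv]; rewrite ltNge tv.
- exact: measurable_funTS mK.
have c0 := expR_ge0 (- (Q T - Q x)).
have cle t : T < t -> expR (- (Q t - Q x)) <= expR (- (Q T - Q x)).
  move=> Tt; rewrite ler_expR lerN2 lerD2r.
  exact: (phase_nondecreasing cr r0 lq q0 (ltW Tt)).
apply: leeD.
- apply: (@le_trans _ _ (\int[mu]_(t in `[x, T]) (`|f t| `^ p)%:E)%E).
    apply: ge0_le_integral => //.
    + exact: measurable_funTS mK.
    + by apply: measurable_funTS; apply/measurable_EFinP.
    + move=> t /=; rewrite in_itv/= => /andP[xt _].
      by rewrite lee_fin ler_piMl ?powR_ge0// phase_kernel_le1.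
  apply: ge0_subset_integral => //.
    by apply: measurable_funTS; apply/measurable_EFinP.
  by apply: subset_itvr.
- move: c0 cle; set c := expR (- (Q T - Q x)); clearbody c => c0 cle.
  have -> : (c%:E * \int[mu]_t (`|f t| `^ p)%:E =
      \int[mu]_t (c%:E * (`|f t| `^ p)%:E))%E.
    by rewrite ge0_integralZl//; apply/measurable_EFinP.
  have mcf : measurable_fun setT (fun t => (c%:E * (`|f t| `^ p)%:E)%E).
    by apply: measurable_funeM; apply/measurable_EFinP.
  have cf0 t : (0 <= c%:E * (`|f t| `^ p)%:E)%E.
    by rewrite mule_ge0// lee_fin powR_ge0.
  apply: (@le_trans _ _ (\int[mu]_(t in `]T, +oo[) (c%:E * (`|f t| `^ p)%:E))%E).
    apply: ge0_le_integral => //.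
    + exact: measurable_funTS mK.
    + exact: measurable_funTS mcf.
    + move=> t /=; rewrite in_itv/= andbT => Tt.
      by rewrite -EFinM lee_fin ler_wpM2r ?powR_ge0// cle.
  exact: ge0_subset_integral.
Qed.

Lemma G_op_cvg_ninfty : G_op r q f x @[x --> -oo] --> 0.
Proof.
apply/cvgrPdist_lt => e e0; have [d d0 Hd] := G_op_small e0.
have d20 : 0 < d / 2 by rewrite divr_gt0.
have [M HM] := tails_small mfp (fun=> powR_ge0 _ _) fpoo d20.
pose T := - M - 1.
have [tot totE] : exists tot, (\int[mu]_t (`|f t| `^ p)%:E = tot%:E)%E.
  exists (fine (\int[mu]_t (`|f t| `^ p)%:E)%E); rewrite fineK// ge0_fin_numE//.
  by apply: integral_ge0 => t _; rewrite lee_fin powR_ge0.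
have tot0 : 0 <= tot.
  by rewrite -lee_fin -totE; apply: integral_ge0 => t _; rewrite lee_fin powR_ge0.
have [X HX] := phase_ninfty (Q T - 2 * tot / d).
near=> x; rewrite sub0r normrN; apply: Hd.
have xT : x <= T by near: x; apply: nbhs_ninfty_le; exact: num_real.
have xX : x <= X by near: x; apply: nbhs_ninfty_le; exact: num_real.
apply: le_trans (damped_power_split xT) _.
have -> : d = d / 2 + d / 2 by field.
rewrite EFinD; apply: leeD.
  apply: le_trans HM; apply: ge0_subset_integral => //.
  - by apply: measurableC.
  - by apply: measurable_funTS; apply/measurable_EFinP.
  - move=> t /=; rewrite !in_itv/= => tT; apply/negP; rewrite negb_and.
    by rewrite -!ltNge; apply/orP; left; move: tT; rewrite /T => ?; lra.
rewrite totE -EFinM lee_fin.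
set s := Q T - Q x.
have hs : 2 * tot / d <= s by have := HX x xX; rewrite /s; lra.
have s0 : 0 <= s by apply: le_trans hs; rewrite divr_ge0 ?mulr_ge0// ltW.
have h2 : expR (- s) * (1 + s) <= 1.
  rewrite -[leRHS](expR0 R) -(addNr s) expRD ler_wpM2l ?expR_ge0//.
  exact: expR_ge1Dx.
have h3 : tot <= d / 2 * (1 + s).
  move: hs; rewrite ler_pdivrMr// => hs.
  have : 0 <= d / 2 by exact: ltW.
  by rewrite mulrDr mulr1; lra.
apply: (@le_trans _ _ (expR (- s) * (d / 2 * (1 + s)))).
  by rewrite ler_wpM2l ?expR_ge0.
by rewrite mulrCA ler_piMr// ltW.
Unshelve. all: by end_near. Qed.

Lemma G_op_solution : is_solution r q f (G_op r q f).
Proof.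
have [acG odeG] := G_op_ode; split => //.
- exact: G_op_cvg_ninfty.
- exact: G_op_cvg_pinfty.
Qed.

End green_solves.

(** * Necessity of the window condition *)

Section necessity.
Context {R : realType}.
Local Notation mu := (@lebesgue_measure R).
Context (r q : R -> R) (cr : continuous r) (r0 : forall x, 0 < r x)
  (lq : locally_integrable setT q) (q0 : {ae mu, forall x : R, 0 <= q x}).
Local Notation Q := (qr_phase r q).

Lemma solution_bounded (f y : R -> R) : is_solution r q f y ->
  exists M, forall x, `|y x| <= M.
Proof.
move=> [acy _ yNoo yoo].
move/cvgrPdist_lt : yNoo => /(_ _ ltr01) [a [_ Ha]].
move/cvgrPdist_lt : yoo => /(_ _ ltr01) [b [_ Hb]].
have [M M0 HM] := ac_bounded (acy a b).
exists (M + 1) => x.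
have [xa|ax] := ltP x a.
  by have := Ha x xa; rewrite sub0r normrN => /ltW; lra.
have [bx|xb] := ltP b x.
  by have := Hb x bx; rewrite sub0r normrN => /ltW; lra.
by have := HM x; rewrite ax xb => /(_ isT); lra.
Qed.

(** For nonnegative f the integral in the representation formula increases with
its upper end c, while e^{-Q(c)} y(c) tends to 0; the weight is at least e^{-2} on
[a, b]. *)
Lemma solution_lower (f y : R -> R) (a b : R) : locally_integrable setT f ->
  (forall t, 0 <= f t) -> is_solution r q f y -> a <= b -> Q b - Q a <= 2 ->
  expR (- 2) * \int[mu]_(t in `[a, b]) (f t / r t) <= y a.
Proof.
have H (u v w i1 i2 i3 : R) : u - v = i2 -> i1 <= i2 -> i3 <= i1 -> - w <= v ->
  i3 <= u + w by lra.
have H2 (s t v e : R) : 0 <= s -> s <= t -> `|v| <= e -> - (t * e) <= s * v.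
  move=> s0 st ve; have e0 : 0 <= e by exact: le_trans ve.
  have /ler_normlP[ve' _] := ve.
  rewrite lerNl -mulrN; apply: (@le_trans _ _ (s * e)); first by rewrite ler_wpM2l.
  by rewrite ler_wpM2r.
move=> lf f0 sy ab Qab.
have ndQ := phase_nondecreasing cr r0 lq q0.
apply/ler_addgt0Pr => e e0.
have [_ _ _ yoo] := sy.
near (pinfty_nbhs R) => c.
have bc : b <= c by near: c; apply: nbhs_pinfty_ge; exact: num_real.
have yc : `|y c| < e.
  near: c; move/cvgrPdist_lt : yoo => /(_ _ e0).
  by apply: filterS => c; rewrite sub0r normrN.
have h4 : - (expR (- Q a) * e) <= expR (- Q c) * y c.
  have Qac : expR (- Q c) <= expR (- Q a).
    by rewrite ler_expR lerN2; exact: ndQ (le_trans ab bc).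
  exact: H2 (expR_ge0 _) Qac (ltW yc).
have lfr := locint_divr cr r0 lf.
pose psi t := expR (- Q t) * (f t / r t).
have lpsi : locally_integrable setT psi.
  by apply: damp_locint => //; exact: locint_divr.
have psi0 t : 0 <= psi t by rewrite mulr_ge0 ?expR_ge0// divr_ge0// ltW.
have h2 : expR (- Q a) * (expR (- 2) * \int[mu]_(t in `[a, b]) (f t / r t)) <=
    \int[mu]_(t in `[a, b]) psi t.
  rewrite mulrA -expRD.
  have -> : expR (- Q a + -2) * \int[mu]_(t in `[a, b]) (f t / r t) =
      \int[mu]_(t in `[a, b]) (expR (- Q a + -2) * (f t / r t)).
    by apply/esym/RintegralZl => //; exact: locint_itv.
  apply: le_Rintegral => //.
  - apply: locint_itv; apply: locint_cM => //.
    by move=> t; exact: cvg_cst.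
  - exact: locint_itv.
  - move=> t /=; rewrite in_itv/= => /andP[at_ tb].
    apply: ler_wpM2r; first by rewrite divr_ge0 ?(ltW (r0 _)).
    rewrite ler_expR -opprD lerN2; apply: le_trans (ndQ _ _ tb) _.
    by rewrite -lerBlDl.
have h1 : \int[mu]_(t in `[a, b]) psi t <= \int[mu]_(t in `[a, c]) psi t.
  rewrite (Rintegral_split lpsi ab bc) lerDl.
  by apply: Rintegral_ge0 => t _; exact: psi0.
rewrite -(ler_pM2l (expR_gt0 (- Q a))) mulrDr.
exact: H (solution_repr cr r0 lq lf sy (le_trans ab bc)) h1 h2 h4.
Unshelve. all: by end_near. Qed.

Context (mass_at_scale : exists2 a : R, 0 < a &
    (0 < ereal_inf (range (fun x : R => qr_integral r q x a)))%E).
Context (p : R) (p1 : 1 < p).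
Local Notation p' := (p / (p - 1)).
Local Notation d := (d_fun r q).

Let p0 : 0 < p. Proof. exact: lt_trans p1. Qed.

Definition window_mass (x : R) : R :=
  \int[mu]_(t in `[x - d x, x + d x]) (r t `^ p')^-1.
Local Notation B := window_mass.

Lemma locint_rpow : locally_integrable setT (fun t => (r t `^ p')^-1).
Proof.
apply: continuous_locint.
have -> : (fun t => (r t `^ p')^-1) = (fun t => expR (- (p' * ln (r t)))).
  by apply/funext => t; rewrite expRN /powR gt_eqF.
move=> t; apply: continuous_comp; last exact: continuous_expR.
apply: cvgN; apply: cvgM; first exact: cvg_cst.
by apply: continuous_comp; [exact: cr|exact: continuous_ln].
Qed.

Lemma window_massE x :
  (\int[mu]_(t in `[(x - d x)%R, (x + d x)%R]) ((r t `^ p')^-1)%:E = (B x)%:E)%E.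
Proof.
rewrite /window_mass /Rintegral fineK//; apply: integrable_fin_num => //.
exact: locint_itv locint_rpow.
Qed.

Lemma window_mass_unbounded : A_sup r q p' = +oo%E ->
  forall M, exists x, M <= B x.
Proof.
move=> Aoo M; apply: contrapT => /forallNP H.
have : (A_sup r q p' <= M%:E)%E.
  apply: ge_ereal_sup => _ [x _ <-]; rewrite window_massE lee_fin.
  by rewrite leNgt; apply/negP => /ltW; exact: H.
by rewrite Aoo leye_eq.
Qed.

(** The gliding hump: f^p = r^{-p'} \sum_k 2^{-(k+1)} 1_{D_k} / B_k with windows
D_k of mass B_k >= ((k+1) 2^{k+1})^{p'}. All terms are nonnegative, so each of them
alone bounds f from below and the windows may overlap. *)
Lemma unbounded_solution_data : A_sup r q p' = +oo%E ->
  exists f : R -> R, [/\ f \in Lfun mu p%:E, forall t, 0 <= f t &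
    forall k : nat, exists x, k%:R <=
      \int[mu]_(t in `[x - d x, x + d x]) (f t / r t)].
Proof.
move=> Aoo.
have [c cP] := choice (fun k : nat =>
  window_mass_unbounded Aoo ((k.+1%:R * (2 ^ k.+1)%:R) `^ p')).
pose D k : set R := `[c k - d (c k), c k + d (c k)]%classic.
pose h k t : R := ((2 ^ k.+1)%:R^-1 / B (c k)) * (r t `^ p')^-1 * \1_(D k) t.
have mD k : measurable (D k) by exact: measurable_itv.
have p'0 : 0 < p' by exact: conj_gt0.
have B1 k : 1 <= B (c k).
  apply: le_trans (cP k); rewrite -[leLHS](powRr0 (k.+1%:R * (2 ^ k.+1)%:R)).
  apply: ler_powR; last exact: ltW.
  by rewrite -natrM ler1n muln_gt0 expn_gt0.
have B0 k : 0 < B (c k) by exact: lt_le_trans (B1 k).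
have rp0 t : 0 <= (r t `^ p')^-1 by rewrite invr_ge0 powR_ge0.
have w0 k : 0 <= (2 ^ k.+1)%:R^-1 / B (c k) by rewrite divr_ge0// ltW.
have h0 k t : 0 <= h k t by rewrite /h mulr_ge0// mulr_ge0.
have [mrp _ _] := locint_rpow.
have mh k : measurable_fun setT (h k).
  apply: measurable_funM; last exact: measurable_indic.
  exact: measurable_funM.
pose G t : \bar R := (\sum_(k <oo) (h k t)%:E)%E.
have G0 t : (0 <= G t)%E by apply: nneseries_ge0 => k _ _; rewrite lee_fin.
(* Since B_k >= 1, the series is dominated by r(t)^{-p'} \sum_k 2^{-(k+1)}. *)
have Gfin t : (G t \is a fin_num)%E.
  rewrite ge0_fin_numE//.
  apply: (@le_lt_trans _ _ (\sum_(k <oo) ((r t `^ p')^-1 / (2 ^ k.+1)%:R)%:E)%E).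
    apply: lee_nneseries => [k _ _|k _]; rewrite lee_fin//.
    rewrite /h -[leRHS]mulr1; apply: ler_pM.
    - by rewrite mulr_ge0.
    - by [].
    - by rewrite mulrC ler_wpM2l// ler_pdivrMr// ler_peMr// invr_ge0.
    - by rewrite indicE; case: (_ \in _).
  by apply: le_lt_trans (epsilon_trick0 _ (rp0 t)) _; rewrite ltry.
have hG k t : h k t <= fine (G t).
  rewrite -lee_fin fineK//; apply: le_trans (nneseries_lim_ge k.+1 _); last first.
    by move=> n _ _; rewrite lee_fin.
  rewrite big_nat_recr//= leeDr// sume_ge0// => i _; by rewrite lee_fin.
have mG : measurable_fun setT (fun t => fine (G t)).
  apply: measurableT_comp => //; apply: ge0_emeasurable_sum => //.
  - by move=> k t _ _; rewrite lee_fin.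
  - by move=> k _; apply/measurable_EFinP.
have Goo : (\int[mu]_t G t < +oo)%E.
  have mhE k : measurable_fun setT (fun t => (h k t)%:E) by exact/measurable_EFinP.
  have hE0 k t : setT t -> (0 <= (h k t)%:E)%E by rewrite lee_fin.
  have -> : (\int[mu]_t G t = \sum_(k <oo) \int[mu]_t (h k t)%:E)%E.
    by apply: integral_nneseries.
  apply: (@le_lt_trans _ _ (\sum_(k <oo) (1 / (2 ^ k.+1)%:R)%:E)%E).
    apply: lee_nneseries => [k _ _|k _].
      by apply: integral_ge0 => t _; rewrite lee_fin.
    have -> : (\int[mu]_t (h k t)%:E = \int[mu]_(t in D k)
       (((2 ^ k.+1)%:R^-1 / B (c k))%:E * ((r t `^ p')^-1)%:E))%E.
      rewrite [RHS]integral_mkcond; apply: eq_integral => t _.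
      rewrite patchE /h indicE; case: ifPn => _; first by rewrite mulr1 EFinM.
      by rewrite mulr0.
    rewrite ge0_integralZl//.
    - by rewrite window_massE -EFinM lee_fin div1r divfK// gt_eqF.
    - exact: mD.
    - by apply/measurable_EFinP; exact: measurable_funTS.
    - by move=> t _; rewrite lee_fin.
    - by rewrite lee_fin.
  by apply: le_lt_trans (epsilon_trick0 _ ler01) _; rewrite ltry.
pose f t := fine (G t) `^ p^-1.
have f0 t : 0 <= f t by exact: powR_ge0.
have fine0 t : 0 <= fine (G t) by exact: fine_ge0.
have mf : measurable_fun setT f by exact: measurable_powR_comp.
have fp : f \in Lfun mu p%:E.
  rewrite inE/=; apply/andP; split; first by rewrite inE.
  rewrite inE/= /finite_norm unlock /=; apply: poweR_lty.
  have -> : (\int[mu]_t (`|(f t)%:E| `^ p) = \int[mu]_t G t)%E.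
    apply: eq_integral => t _ /=; rewrite ger0_norm// /f.
    by rewrite powRrK ?gt_eqF// fineK.
  exact: Goo.
exists f; split => // k; exists (c k).
have lfr := locint_divr cr r0 (Lfun_locint (ltW p1) fp).
pose s := (((2 ^ k.+1)%:R^-1 / B (c k)) `^ p^-1).
apply: (@le_trans _ _ (\int[mu]_(t in D k) (s * (r t `^ p')^-1))); last first.
  apply: le_Rintegral => //.
  - exact: mD.
  - apply: locint_itv; apply: locint_cM; first exact: locint_rpow.
    by move=> t; exact: cvg_cst.
  - exact: locint_itv.
  move=> t Dt; rewrite ler_pdivlMr//.
  (* p' / p + 1 = p' turns f / r into a multiple of r^{-p'}. *)
  have -> : s * (r t `^ p')^-1 * r t = (h k t) `^ p^-1.
    rewrite /h indicE mem_set// mulr1 (powRM _ (w0 k) (rp0 t)) -/s -mulrA; congr (_ * _).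
    rewrite -powRN -powRrM -[X in _ * X]powRr1 ?(ltW (r0 t))// -powRD; last first.
      by rewrite (gt_eqF (r0 t)) implybT.
    congr (_ `^ _); field.
    by apply/andP; split; rewrite gt_eqF// subr_gt0.
  by rewrite ge0_ler_powR ?nnegrE// ?invr_ge0 ?(ltW p0)// hG.
rewrite RintegralZl; [|exact: mD|by apply: locint_itv; exact: locint_rpow].
rewrite -/(window_mass (c k)).
have hB : k.+1%:R * (2 ^ k.+1)%:R <= B (c k) `^ p'^-1.
  have := cP k; set m := _ * _ => mB.
  have m0 : 0 <= m by rewrite mulr_ge0.
  rewrite -[leLHS](@powRrK _ m p'^-1) ?invr_neq0 ?gt_eqF// invrK.
  apply: ge0_ler_powR; rewrite ?nnegrE ?invr_ge0 ?powR_ge0 ?(ltW p'0) ?(ltW (B0 k))//.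
have sE : s * B (c k) = (2 ^ k.+1)%:R^-1 `^ p^-1 * B (c k) `^ p'^-1.
  have BV0 : 0 <= (B (c k))^-1 by rewrite invr_ge0 ltW.
  have c0 : 0 <= (2 ^ k.+1)%:R^-1 :> R by rewrite invr_ge0.
  rewrite /s (powRM _ c0 BV0) -mulrA; congr (_ * _).
  rewrite powR_inv ?(ltW (B0 k))// -[X in _ * X]powRr1 ?(ltW (B0 k))// -powRN -powRD.
    by congr (_ `^ _); have := conj_add p1; lra.
  by rewrite (gt_eqF (B0 k)) implybT.
rewrite sE.
have c2 : (2 ^ k.+1)%:R^-1 <= (2 ^ k.+1)%:R^-1 `^ p^-1 :> R.
  apply: ger1_powR; last by rewrite invf_le1// ltW.
  by rewrite invr_gt0 ltr0n expn_gt0/= invf_le1 ?ltr0n ?expn_gt0// ler1n expn_gt0.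
apply: (@le_trans _ _ ((2 ^ k.+1)%:R^-1 * (k.+1%:R * (2 ^ k.+1)%:R))).
  by rewrite mulrCA mulVf ?mulr1 ?ler_nat// pnatr_eq0 -lt0n expn_gt0.
by apply: ler_pM => //; rewrite ?invr_ge0// mulr_ge0.
Qed.

Lemma solvable_A_sup_lty :
  (forall f : R -> R, f \in Lfun mu p%:E -> exists y, is_solution r q f y) ->
  (A_sup r q p' < +oo)%E.
Proof.
move=> solv; rewrite ltey; apply/eqP => Aoo.
have [f [fp f0 fk]] := unbounded_solution_data Aoo.
have [y sy] := solv f fp.
have [M HM] := solution_bounded sy.
have lf := Lfun_locint (ltW p1) fp.
pose k := Num.bound (expR 2 * M).
have [x kx] := fk k.
have [D D0 HD] := phase_growth cr r0 lq mass_at_scale.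
have [dx _ Qd] := d_fun_spec cr r0 lq q0 D0 HD x.
have h := @solution_lower f y (x - d x) (x + d x) lf f0 sy.
have {}h : expR (- 2) * \int[mu]_(t in `[x - d x, x + d x]) (f t / r t) <= y (x - d x).
  by apply: h; [lra|rewrite Qd].
have h1 := le_trans (ler_wpM2l (expR_ge0 (- 2)) kx) (le_trans h (le_trans (ler_norm _) (HM _))).
have M0 : 0 <= M by exact: le_trans (HM 0).
have : expR 2 * M < k%:R by apply: archi_boundP; rewrite mulr_ge0// expR_ge0.
rewrite ltNge; apply/negP; rewrite negbK.
have e2 : expR 2 * expR (- 2) = 1 :> R by rewrite -expRD subrr expR0.
by have := ler_wpM2l (expR_ge0 2) h1; rewrite mulrA e2 mul1r.
Qed.

End necessity.

(** * The criterion *)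

Lemma green_constant_le (R : realType) (A d p : R) : 1 < p -> 0 <= A -> 0 <= d ->
  (2 * A) `^ (p / (p - 1))^-1 * (4 * d) `^ p^-1 <=
  4 * d `^ p^-1 * A `^ (p / (p - 1))^-1.
Proof.
move=> p1 A0 d0; have pp' := conj_add p1.
have p'0 : 0 <= (p / (p - 1))^-1 by rewrite invr_ge0 ltW// conj_gt0.
rewrite !powRM//.
have h : 2 `^ (p / (p - 1))^-1 * 4 `^ p^-1 <= 4 :> R.
  apply: (@le_trans _ _ (4 `^ (p / (p - 1))^-1 * 4 `^ p^-1)).
    by rewrite ler_wpM2r ?powR_ge0// ge0_ler_powR ?nnegrE//; lra.
  by rewrite -powRD addrC pp' ?powRr1// ?oner_eq0.
rewrite mulrACA [X in _ * X]mulrC mulrA ler_wpM2r ?powR_ge0//.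
by rewrite ler_wpM2r ?powR_ge0.
Qed.

Unset Implicit Arguments.
Set Strict Implicit.
Set Printing Implicit Defensive.

Theorem theorem2p4 (R : realType) :
  exists2 c : R, 0 < c &
  forall (r q : R -> R) (p : R),
    continuous r -> (forall x : R, 0 < r x) ->
    locally_integrable setT q ->
    {ae (@lebesgue_measure R), forall x : R, 0 <= q x} ->
    1 < p ->
    (exists2 a : R, 0 < a &
       (0 < ereal_inf (range (fun x : R => qr_integral r q x a)))%E) ->
    let p' := p / (p - 1) in
    (correctly_solvable p r q <-> (A_sup r q p' < +oo)%E) /\
    (G_norm p r q <= c%:E * d_sup r q `^ p^-1 * A_sup r q p' `^ p'^-1)%E.
Proof.
exists 4 => // r q p cr r0 lq q0 p1 mass p'.
have [d0 d00 dE] := d_sup_bounds cr r0 lq q0 mass.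
have hd z : d_fun r q z <= d0.
  by rewrite -lee_fin -dE; apply: ereal_sup_ubound; exists z.
have A_real : (A_sup r q p' < +oo)%E -> exists2 A : R, 0 <= A & A_sup r q p' = A%:E.
  move=> Aoo.
  have : (0 <= A_sup r q p')%E.
    apply: ereal_sup_ge; eexists; first by exists 0.
    by apply: integral_ge0 => t _; rewrite lee_fin invr_ge0 powR_ge0.
  by case: (A_sup r q p') Aoo => [A _ A0|//|//]; exists A.
split; first split.
- move=> [solv _]; apply: (solvable_A_sup_lty cr r0 lq q0 mass p1) => f fp.
  by have [y [[sy _] _]] := solv f fp; exists y.
- move=> /A_real[A A0 AE]; have hA : (A_sup r q p' <= A%:E)%E by rewrite AE.
  split=> [f fp|].
    exists (G_op r q f); split.
      split; first exact: (G_op_solution cr r0 lq q0 mass p1 hA fp).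
      exact: (G_op_Lfun cr r0 lq q0 mass p1 hA fp).
    move=> y [sy _]; apply: (solution_unique cr r0 lq q0 (Lfun_locint (ltW p1) fp) _ sy).
    exact: (G_op_solution cr r0 lq q0 mass p1 hA fp).
  pose C := (2 * A) `^ p'^-1 * (4 * d0) `^ p^-1.
  have C0 : 0 <= C by rewrite mulr_ge0 ?powR_ge0.
  exists (C + 1) => [|f y fp sy _]; first by lra.
  have -> : y = G_op r q f.
    apply: (solution_unique cr r0 lq q0 (Lfun_locint (ltW p1) fp) sy).
    exact: (G_op_solution cr r0 lq q0 mass p1 hA fp).
  apply: le_trans (G_op_Lnorm cr r0 lq q0 mass p1 hA fp hd (ltW d00)) _.
  by rewrite lee_wpmul2r ?Lnorm_ge0// lee_fin lerDl.
- have [Aoo|] := eqVneq (A_sup r q p') +oo%E.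
    rewrite Aoo dE poweRyr; last first.
      by rewrite invr_neq0// gt_eqF// conj_gt0.
    rewrite gt0_muley ?leey// mule_gt0//.
    by rewrite poweR_EFin lte_fin powR_gt0.
  rewrite -ltey => /A_real[A A0 AE]; have hA : (A_sup r q p' <= A%:E)%E by rewrite AE.
  pose C := (2 * A) `^ p'^-1 * (4 * d0) `^ p^-1.
  apply: (@le_trans _ _ C%:E); last first.
    by rewrite AE dE !poweR_EFin -!EFinM lee_fin green_constant_le// ltW.
  apply: ereal_inf_lbound; exists C => //; split; first by rewrite mulr_ge0 ?powR_ge0.
  move=> f fp; split.
  + move=> x; exact: (G_integrand_integrable cr r0 lq q0 mass p1 fp hA).
  + exact: (G_op_Lfun cr r0 lq q0 mass p1 hA fp).
  + exact: (G_op_Lnorm cr r0 lq q0 mass p1 hA fp hd (ltW d00)).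
Qed.
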